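(* Let $\mathcal B$ be a chordal building set on a finite set $S\subset\mathbb N$ with $|S|=2k$, $k\ge2$, such that no connected component of $\mathcal B$ has odd cardinality. Then the order complex $\Delta(\mathcal P_{\mathcal B})$ is shellable, and its geometric realization is homotopy equivalent to a wedge (bouquet) of finitely many $(k-2)$-dimensional spheres.
   Context: A building set on a finite set $S\subset\mathbb N$ is a collection $\mathcal B$ of nonempty subsets of $S$ containing every singleton $\{i\}$, $i\in S$, such that $I,J\in\mathcal B$ and $I\cap J\neq\emptyset$ imply $I\cup J\in\mathcal B$. Its connected components are the inclusion-maximal elements of $\mathcal B$. For $I\subseteq S$, $\mathcal B|_I=\{J\in\mathcal B:J\subseteq I\}$. $\mathcal B$ is chordal if for every $I=\{i_1<\dots<i_r\}\in\mathcal B$ and every $1<s<r$, $\{i_s,\dots,i_r\}\in\mathcal B$. $\widehat{\mathcal P}_{\mathcal B}=\{I\subseteq S:\ \mathcal B|_I\text{ has no connected component of odd cardinality}\}$, ordered by inclusion, and $\mathcal P_{\mathcal B}=\widehat{\mathcal P}_{\mathcal B}\setminus\{\emptyset,S\}$ (the proper part). The order complex $\Delta(P)$ of a poset $P$ is the simplicial complex whose simplices are the finite nonempty chains of $P$. A pure $d$-dimensional simplicial complex is shellable if its facets admit an ordering $F_1,F_2,\dots$ such that $(\bigcup_{i<j}F_i)\cap F_j$ is pure of dimension $d-1$ for each $j\ge2$. *)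

(* Defs.v *)
From HB Require Import structures.
From mathcomp Require Import all_boot all_order all_algebra.
From mathcomp Require Import all_classical all_reals all_analysis.
Import numFieldNormedType.Exports.
Import Order.TTheory GRing.Theory Num.Theory.


Set Implicit Arguments.
Unset Strict Implicit.
Unset Printing Implicit Defensive.

(* Building sets.  A finite set S of naturals is modelled as S : {set 'I_n} *)
(* for some n (every finite subset of N lies in some 'I_n); the order on    *)
(* elements is the order of naturals (via val).                             *)

Section BuildingSets.
Variable n : nat.
Implicit Types (S I J : {set 'I_n}) (B : {set {set 'I_n}}).

Definition building_set S B : Prop :=
  [/\ (forall I, I \in B -> I \subset S /\ I != finset.set0),
      (forall i, i \in S -> [set i] \in B) &
      (forall I J, I \in B -> J \in B -> I :&: J != finset.set0 -> I :|: J \in B)].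

Definition bs_components B : {set {set 'I_n}} :=
  [set I in B | [forall J in B, (I \subset J) ==> (J == I)]].

Definition bs_restrict B I : {set {set 'I_n}} := [set J in B | J \subset I].

(* chordality: for I = {i_1 < ... < i_r} in B and 1 < s < r, the tail
   {i_s, ..., i_r} is in B.  The tail {i_s,...,i_r} is the set of j in I
   having at least s-1 elements of I strictly below them; we write t = s-1,
   so 1 < s < r becomes 1 <= t and t + 2 <= r. *)
Definition tail_from I (t : nat) : {set 'I_n} :=
  [set j in I | (t <= #|[set i in I | (val i < val j)%N]|)%N].

Definition chordal B : Prop :=
  forall I, I \in B -> forall t : nat, (1 <= t)%N -> (t + 2 <= #|I|)%N ->
    tail_from I t \in B.

Definition hatP S B : {set {set 'I_n}} :=
  [set I : {set 'I_n} | (I \subset S) &&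
     [forall C in bs_components (bs_restrict B I), ~~ odd #|C|]].

Definition proper_part_PB S B : {set {set 'I_n}} := hatP S B :\: [set finset.set0; S].

End BuildingSets.

(* Finite abstract simplicial complexes on a finite vertex type V, given by *)
(* their set of (nonempty) faces; order complexes; shellability.           *)

Section Complexes.
Variable V : finType.
Implicit Types (K : {set {set V}}) (P : {set V}).

Definition order_complex (T : finType) (P : {set {set T}}) : {set {set {set T}}} :=
  [set C : {set {set T}} | [&& C != finset.set0, C \subset P &
     [forall X in C, forall Y in C, (X \subset Y) || (Y \subset X)]]].

Definition facets_cx K : {set {set V}} :=
  [set F in K | [forall G in K, (F \subset G) ==> (G == F)]].

Definition pure_cx K (d : nat) : Prop :=
  forall F, F \in facets_cx K -> #|F| = d.+1.

(* For a list s of facets_cx and 0 < j < size s, the complex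
   (F_1 \cup ... \cup F_{j-1}) \cap F_j (all of its faces, including the
   empty face) *)
Definition shell_inter (s : seq {set V}) (j : nat) : {set {set V}} :=
  [set G : {set V} | (G \subset nth finset.set0 s j) &&
     has (fun Fi : {set V} => G \subset Fi) (take j s)].

Definition pure_dim_pred (L : {set {set V}}) (d : nat) : Prop :=
  (forall G, G \in L -> (#|G| <= d)%N) /\
  (forall G, G \in L -> exists2 G', G' \in L & G \subset G' /\ #|G'| = d).

Definition shellable_cx K : Prop :=
  exists d : nat, pure_cx K d /\
    exists s : seq {set V},
      [/\ uniq s, (forall F, F \in s <-> F \in facets_cx K) &
          (forall j : nat, (0 < j < size s)%N -> pure_dim_pred (shell_inter s j) d)].

End Complexes.

Local Open Scope classical_set_scope.
Local Open Scope ring_scope.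

Definition geom_realization (R : realType) (V : finType) (K : {set {set V}})
  : set 'rV[R]_#|V| :=
  [set x : 'rV[R]_#|V| | (forall i, 0 <= x ord0 i) /\ \sum_i x ord0 i = 1 /\
           [set v : V | x ord0 (enum_rank v) != 0]%SET \in K].

Definition homotopic_within (R : realType) (X : topologicalType) (A : set X)
  (f0 f1 : X -> X) : Prop :=
  exists H : R * X -> X,
    [/\ {within [set p | 0 <= p.1 <= 1 /\ A p.2], continuous H},
        (forall p, 0 <= p.1 <= 1 -> A p.2 -> A (H p)) &
        (forall x, A x -> H (0, x) = f0 x /\ H (1, x) = f1 x)].

Definition homotopy_equiv (R : realType) (X Y : topologicalType)
  (A : set X) (B : set Y) : Prop :=
  exists (f : X -> Y) (g : Y -> X),
    [/\ {within A, continuous f}, f @` A `<=` B,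
        {within B, continuous g} & g @` B `<=` A] /\
    homotopic_within R A (g \o f) id /\ homotopic_within R B (f \o g) id.

(* wedge of m spheres of dimension d, realized in R^(m x (d+1)): the i-th
   sphere is the unit d-sphere centred at e_0 in row i (other rows 0);
   all spheres meet exactly at the origin.  For m = 0 it is a point. *)
Definition wedge_spheres (R : realType) (m d : nat) : set 'M[R]_(m, d.+1) :=
  [set M | M = 0 \/
     exists i : 'I_m, (forall j : 'I_m, j != i -> row j M = 0) /\
       \sum_(c < d.+1) (M i c - (c == ord0)%:R) ^+ 2 = 1].

Arguments geom_realization R {V} K _.
Arguments wedge_spheres R m d _ : clear implicits.

(* Main.v *)
(** Read the maximal chains of the poset from the top, Sb = x_0 > ... > x_k = 0:
    step i removes a pair of elements lying in one component of B|x_i. Order the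
    chains lexicographically, comparing a step first by the component of the
    removed pair (through the largest element of the component of B|x_l that
    contains it, for l = 0, ..., i in turn) and then by the pair itself. Since
    tails of connected sets are connected, the two lowest removable elements of
    a component can always be removed first; this gives the exchange property
    of a lexicographic shelling.

    In a shellable complex, postpone the facets whose whole boundary is already
    covered when they are added. The other facets form a complex that collapses
    to a point by explicit retractions, and crushing it turns each postponed
    facet into a sphere. The crushing map, written with an inversion, is an
    explicit map onto the wedge; it is a homotopy equivalence because the
    contraction extends over the postponed facets. *)

Require Import Defs.
From HB Require Import structures.
From mathcomp Require Import all_boot all_order all_algebra.

Set Implicit Arguments.
Unset Strict Implicit.
Unset Printing Implicit Defensive.

(** * Lexicographic shelling of the even poset of a chordal building set *)

Section ChordalPoset.
Variables (n : nat) (Sb : {set 'I_n}) (B : {set {set 'I_n}}).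
Hypotheses (bB : building_set Sb B) (chB : chordal B).
Implicit Types (T U I K C D X w y e z : {set 'I_n}) (u v a b c : 'I_n).
Local Notation L := (hatP Sb B).

(** The obstacle is that removing a pair may split a component, so an order read from the current
    components alone could reverse a comparison made one step earlier. Since a step remembers the
    components of its pair in all earlier sets, a comparison decided between two components stays
    decided. Within one old component, the choice of the largest element as label does the work:
    after [a < b] have left, the elements above [b] still form a tail, so they stay in one piece,
    and that piece has the largest label.

    On the topological side, each map out of a realization is one formula in barycentric
    coordinates, continuous on the whole ambient space; minima and maxima replace case distinctions,
    so nothing has to be glued. Only the inverse equivalence and one homotopy live on a subspace
    alone, and there continuity comes from compactness. *)

Definition conn T u v := [exists K in B, [&& K \subset T, u \in K & v \in K]].
Definition component T u : {set 'I_n} := locked [set v | conn T u v].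

Lemma in_component T u v : (v \in component T u) = conn T u v.
Proof. by rewrite /component -lock inE. Qed.

Lemma connP T u v : reflect (exists K, [/\ K \in B, K \subset T, u \in K & v \in K]) (conn T u v).
Proof.
apply: (iffP exists_inP) => [[K KB /and3P[]]|[K [KB KT uK vK]]]; first by exists K.
by exists K => //; apply/and3P.
Qed.

Lemma conn_sym T u v : conn T u v = conn T v u.
Proof. by apply: eq_existsb => K; rewrite [(u \in K) && _]andbC. Qed.

Lemma conn_trans T u v c : conn T u v -> conn T v c -> conn T u c.
Proof.
have [_ _ unionB] := bB.
move=> /connP[K [KB KT uK vK]] /connP[K' [KB' KT' vK' cK']].
apply/connP; exists (K :|: K'); split; rewrite ?subUset ?KT ?inE ?uK ?cK' ?orbT //.
by apply: unionB => //; apply/set0Pn; exists v; rewrite inE vK.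
Qed.

Lemma conn_mono T T' u v : T \subset T' -> conn T u v -> conn T' u v.
Proof.
move=> TT' /connP[K [KB KT uK vK]]; apply/connP; exists K.
by split=> //; exact: subset_trans TT'.
Qed.

Lemma conn_memr T u v : conn T u v -> v \in T.
Proof. by move=> /connP[K [_ /subsetP KT _ /KT]]. Qed.

Lemma conn_refl T u : T \subset Sb -> u \in T -> conn T u u.
Proof.
have [_ sB _] := bB; move=> /subsetP TS uT; apply/connP; exists [set u].
by split; rewrite ?sub1set ?set11 // sB // TS.
Qed.

Lemma mem_component T u : T \subset Sb -> u \in T -> u \in component T u.
Proof. by move=> TS uT; rewrite in_component conn_refl. Qed.

Lemma component_sub T u : component T u \subset T.
Proof. by apply/subsetP => v; rewrite in_component => /conn_memr. Qed.

Lemma component_mono T T' u : T \subset T' -> component T u \subset component T' u.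
Proof. by move=> TT'; apply/subsetP => v; rewrite !in_component; exact: conn_mono. Qed.

Lemma component_eq T u v : v \in component T u -> component T v = component T u.
Proof.
rewrite in_component => uv; apply/setP => c; rewrite !in_component.
apply/idP/idP; first exact: conn_trans.
by apply: conn_trans; rewrite conn_sym.
Qed.

Lemma component_max T u K : K \in B -> K \subset T -> u \in K -> K \subset component T u.
Proof.
by move=> KB KT uK; apply/subsetP => v vK; rewrite in_component; apply/connP; exists K.
Qed.

Lemma component_building T u : T \subset Sb -> u \in T -> component T u \in B.
Proof.
move=> TS uT; have [_ sB unionB] := bB.
have u1 : [&& [set u] \in B, [set u] \subset T & u \in [set u]].
  by rewrite sub1set uT set11 sB // (subsetP TS).
have [K /maxsetP[/and3P[KB KT uK] Kmax] _] :=
  @maxset_exists _ (fun K => [&& K \in B, K \subset T & u \in K]) _ u1.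
suff -> : component T u = K by [].
apply/eqP; rewrite eqEsubset component_max // andbT; apply/subsetP => v.
rewrite in_component => /connP[K' [KB' KT' uK' vK']].
suff <- : K :|: K' = K by rewrite inE vK' orbT.
apply: Kmax; last exact: subsetUl.
rewrite subUset KT KT' inE uK /= andbT; apply: unionB => //.
by apply/set0Pn; exists u; rewrite inE uK.
Qed.

(** The form in which parity is transported: a component that a removal does not touch stays a
    component. *)
Lemma component_local U U' u : U' \subset Sb -> u \in U' -> U \subset U' ->
  component U' u \subset U -> component U u = component U' u.
Proof.
move=> U'S uU' UU' CU; apply/eqP; rewrite eqEsubset component_mono //=.
by apply: component_max => //; [exact: component_building|exact: mem_component].
Qed.

(** The maximal members of [bs_restrict B I] are the classes of [conn I], so parity can be tested
    point by point. *)
Lemma hatPP I : reflect (I \subset Sb /\ forall u, u \in I -> ~~ odd #|component I u|) (I \in L).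
Proof.
have [B0 _ _] := bB.
rewrite inE; apply: (iffP andP) => -[IS evI]; split=> //.
  move=> u uI; apply: (forall_inP evI); rewrite !inE component_building // component_sub /=.
  apply/forall_inP => J; rewrite inE => /andP[JB JI]; apply/implyP => CJ.
  by rewrite eqEsubset CJ andbT component_max // (subsetP CJ) // mem_component.
apply/forall_inP => C; rewrite !inE => /andP[/andP[CB CI] /forall_inP Cmax].
have [_ /set0Pn[u uC]] := B0 _ CB.
have uI := subsetP CI _ uC.
have cI : component I u \in bs_restrict B I by rewrite inE component_building // component_sub.
by have := Cmax _ cI; rewrite component_max //= => /eqP <-; exact: evI.
Qed.

Lemma hatP_sub I : I \in L -> I \subset Sb.
Proof. by move=> /hatPP[]. Qed.

Lemma hatP_set0 : set0 \in L.
Proof. by apply/hatPP; split; [exact: sub0set|move=> u; rewrite inE]. Qed.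

Lemma hatP_full : (forall C, C \in bs_components B -> ~~ odd #|C|) -> Sb \in L.
Proof.
have [B0 _ _] := bB; move=> evB; rewrite inE subxx; apply/forall_inP => C.
have -> : bs_restrict B Sb = B; last exact: evB.
by apply/setP => J; rewrite inE andb_idr // => /B0[].
Qed.

(** [X] is a disjoint union of components of [I]; the induction splits off one of them. *)
Lemma even_saturated I X : I \in L -> X \subset I ->
  (forall u, u \in X -> component I u \subset X) -> ~~ odd #|X|.
Proof.
move=> /hatPP[IS evI]; have [m] := ubnP #|X|; elim: m X => // m ih X Xm XI satX.
have [->|[u uX]] := set_0Vmem X; first by rewrite cards0.
have uI := subsetP XI _ uX.
rewrite -(cardsID (component I u)) (setIidPr (satX u uX)) oddD (negbTE (evI u uI)) /=.
apply: ih.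
- rewrite ltnS in Xm; apply: leq_trans Xm.
  apply: proper_card; apply/properP; split; first exact: subsetDl.
  by exists u => //; rewrite inE mem_component.
- exact: subset_trans (subsetDl _ _) XI.
- move=> v; rewrite inE => /andP[uv vX]; apply/subsetP => c cv; rewrite inE.
  rewrite (subsetP (satX v vX) _ cv) andbT; apply: contra uv => cu.
  by rewrite -(component_eq cu) (component_eq cv) mem_component // (subsetP XI).
Qed.

Lemma hatP_even I : I \in L -> ~~ odd #|I|.
Proof. by move=> IL; apply: even_saturated IL (subxx _) _ => u _; exact: component_sub. Qed.

(** The part of the component inside [w] is a union of components of [w], hence even. This parity is
    what lets elements be removed in pairs. *)
Lemma even_componentD w y u : w \in L -> y \in L -> w \subset y -> u \in y ->
  ~~ odd #|component y u :\: w|.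
Proof.
move=> wL yL wy uy; have [_ /(_ u uy)] := hatPP _ yL.
rewrite -(cardsID w) oddD; suff /negbTE -> : ~~ odd #|component y u :&: w| by [].
apply: (even_saturated wL); first exact: subsetIr.
move=> v; rewrite inE => /andP[/component_eq <- vw]; rewrite subsetI component_sub andbT.
exact: component_mono.
Qed.

(** Chordality speaks only of proper tails with at least two elements; the full tail is [K] itself
    and the one-element tail is a singleton. *)
Lemma tail_building K v : K \in B -> v \in K -> [set u in K | val v <= val u] \in B.
Proof.
move=> KB vK; pose t := #|[set i in K | val i < val v]|.
have [_ sB _] := bB; have [/(_ K KB)[KS _] _ _] := bB.
have tailE : tail_from K t = [set u in K | val v <= val u].
  apply/setP => j; rewrite !inE; apply: andb_id2l => jK.
  have [vj|jv] := leqP (val v) (val j).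
    apply: subset_leq_card; apply/subsetP => i; rewrite !inE => /andP[-> iv] /=.
    exact: leq_trans vj.
  apply/negbTE; rewrite -ltnNge; apply: proper_card; apply/properP; split.
    apply/subsetP => i; rewrite !inE => /andP[-> ij] /=; exact: ltn_trans jv.
  by exists j; rewrite !inE jK ?jv ?ltnn.
have [t0|t0] := posnP t.
  suff -> : [set u in K | val v <= val u] = K by [].
  apply/setP => u; rewrite inE andb_idr // => uK; rewrite leqNgt; apply/negP => uv.
  by move/cards0_eq: t0 => /setP /(_ u); rewrite !inE uK uv.
have [tK|tK] := leqP (t + 2) #|K|; first by rewrite -tailE; exact: chB.
suff -> : [set u in K | val v <= val u] = [set v] by apply: sB; exact: (subsetP KS).
apply/eqP; rewrite eq_sym eqEcard sub1set inE vK leqnn cards1 /=.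
rewrite -(leq_add2l t); apply: (@leq_trans #|K|); last by move: tK; rewrite addn2 addn1 ltnS.
rewrite -cardsUI [_ :&: _](_ : _ = set0) ?cards0 ?addn0; last first.
  by apply/setP => i; rewrite !inE; case: (i \in K) => //=; rewrite ltnNge andNb.
by apply: subset_leq_card; apply/subsetP => i; rewrite !inE => /orP[] /andP[].
Qed.

Lemma two_lowest X : 1 < #|X| -> exists a b,
  [/\ val a < val b, a \in X, b \in X &
      forall v, v \in X -> [\/ v = a, v = b | val b < val v]].
Proof.
move=> X1; have /set0Pn[u0 uX] : X != set0 by rewrite -card_gt0 ltnW.
pose a := [arg min_(i < u0 in X) val i].
have [aX amin] : a \in X /\ forall v, v \in X -> val a <= val v by rewrite /a; case: arg_minnP.
have /set0Pn[u1 u1X] : X :\ a != set0.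
  by rewrite -card_gt0; move: X1; rewrite (cardsD1 a X) aX add1n ltnS.
pose b := [arg min_(i < u1 in X :\ a) val i].
have [bX bmin] : b \in X :\ a /\ forall v, v \in X :\ a -> val b <= val v.
  by rewrite /b; case: arg_minnP.
move: bX; rewrite !inE => /andP[ba bX]; exists a, b; split=> // [|v vX].
  by rewrite ltn_neqAle amin // andbT eq_sym.
have [->|va] := eqVneq v a; first by constructor 1.
have [->|vb] := eqVneq v b; first by constructor 2.
constructor 3; rewrite ltn_neqAle bmin ?inE ?va // andbT.
by apply: contra vb => /eqP /val_inj ->.
Qed.

(* The part of [component y x] above the removed pair is a tail, hence connected by
   chordality, and it has even cardinality modulo [w]. *)
Lemma remove_lowest w y x a b : w \in L -> y \in L -> w \subset y -> x \in y ->
  val a < val b -> a \in component y x :\: w -> b \in component y x :\: w ->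
  (forall v, v \in component y x :\: w -> [\/ v = a, v = b | val b < val v]) ->
  y :\: [set a; b] \in L.
Proof.
move=> wL yL wy xy ab aD bD abmin; have yS := hatP_sub yL.
set D := component y x in aD bD abmin *; set U := y :\: [set a; b].
have Uy : U \subset y by exact: subsetDl.
have [/setDP[aD' aw] /setDP[bD' bw]] := (aD, bD).
have wU : w \subset U.
  by apply/subsetP => v vw; rewrite !inE (subsetP wy) // andbT; apply/norP;
    split; apply: contraTneq vw => ->.
apply/hatPP; split=> [|u uU]; first exact: subset_trans yS.
have uy := subsetP Uy _ uU.
have [_ evy] := hatPP _ yL; have [_ evw] := hatPP _ wL.
have compUy : component U u \subset component y u by exact: component_mono.
have [uD|uD] := boolP (u \in D); last first.
  rewrite (@component_local U y) ?evy //; apply/subsetP => v vu.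
  rewrite !inE (subsetP (component_sub _ _) _ vu) andbT; apply: contra uD => vab.
  have vD : v \in D by case/orP: vab => /eqP->.
  by rewrite /D -(component_eq vD) (component_eq vu) mem_component.
rewrite (component_eq uD) -/D in compUy.
set E := component U u in compUy *.
pose X := D :\: w :\: [set a; b].
have XE v : v \in X -> val b < val v.
  rewrite inE => /andP[]; rewrite !inE negb_or => /andP[/eqP va /eqP vb].
  by rewrite -in_setD => vD; case: (abmin v vD).
have EU : E \subset U by exact: component_sub.
(* If [E] misses [X] it lies in [w], where it is a whole component and therefore even. *)
have inw : (forall v, v \in E -> v \notin X) -> ~~ odd #|E|.
  move=> EX; have Ew : E \subset w.
    apply/subsetP => v vE; have := EX v vE; have := subsetP EU _ vE.
    by rewrite !inE (subsetP compUy _ vE) => /andP[-> _]; rewrite /= andbT negbK.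
  have uw : u \in w by apply: (subsetP Ew); apply: mem_component => //; exact: subset_trans yS.
  by rewrite /E -(@component_local w U) ?evw //; exact: subset_trans yS.
have [X0|[v0 v0X]] := set_0Vmem X; first by apply: inw => v _; rewrite X0 inE.
pose d := [arg min_(i < v0 in X) val i].
have [dX dmin] : d \in X /\ forall v, v \in X -> val d <= val v by rewrite /d; case: arg_minnP.
have dD : d \in D by move: dX; rewrite !inE => /and3P[].
have bd := XE d dX.
pose Q := [set v in D | val d <= val v].
have QB : Q \in B by apply: tail_building => //; exact: component_building.
have QU : Q \subset U.
  apply/subsetP => v; rewrite !inE => /andP[/(subsetP (component_sub _ _)) -> dv].
  rewrite andbT; apply/norP; split; apply: contraTneq dv => ->; rewrite -ltnNge //.
  exact: ltn_trans bd.
have XQ : X \subset Q.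
  by apply/subsetP => v vX; rewrite inE dmin // andbT; move: vX; rewrite !inE => /and3P[].
have [/existsP[v /andP[vE vX]]|] := boolP [exists v, (v \in E) && (v \in X)]; last first.
  rewrite negb_exists => /forallP EX; apply: inw => v vE.
  by have := EX v; rewrite vE.
have QE : Q \subset E.
  by rewrite /E -(component_eq vE); apply: component_max => //; exact: (subsetP XQ).
(* Once [E] meets [X] it absorbs the tail [Q] that starts at the least element of [X], so outside
   [w] it is all of [D :\: w] except the pair. *)
have EDw : E :\: w = X.
  apply/eqP; rewrite eqEsubset; apply/andP; split; apply/subsetP => c.
    rewrite inE => /andP[cw cE]; have := subsetP EU _ cE.
    by rewrite !inE cw (subsetP compUy _ cE) => /andP[->].
  move=> cX; rewrite inE (subsetP QE) ?(subsetP XQ) // andbT.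
  by move: cX; rewrite !inE => /and3P[].
rewrite -(cardsID w) oddD EDw.
have /negbTE -> /= : ~~ odd #|E :&: w|.
  apply: (even_saturated wL); first exact: subsetIr.
  move=> c; rewrite inE => /andP[cE cw]; rewrite subsetI component_sub andbT.
  by rewrite /E -(component_eq cE); exact: component_mono.
have := even_componentD wL yL wy xy; rewrite -/D (cardsD1 a) aD (cardsD1 b) !inE.
have -> : b != a by apply: contraTneq ab => ->; rewrite ltnn.
rewrite bD' bw /= negbK; congr (~~ odd _).
by apply: eq_card => c; rewrite !inE negb_or; case: (c == a); case: (c == b).
Qed.

Lemma component_removal_disjoint T x e u : T \subset Sb -> e \subset component T x ->
  u \in T -> u \notin component T x -> [disjoint component T u & e].
Proof.
move=> TS eC uT uC; apply/pred0P => v /=; apply/negbTE/negP => /andP[vu /(subsetP eC) vx].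
by case/negP: uC; rewrite -(component_eq vx) (component_eq vu) mem_component.
Qed.

(** A component of the final set lies inside [component T x] or avoids it; either way only one of
    the two removals can affect it. *)
Lemma removals_commute T x e z : T \in L -> x \in T -> e \subset component T x ->
  [disjoint z & component T x] -> T :\: e \in L -> T :\: z \in L -> T :\: e :\: z \in L.
Proof.
move=> TL xT eC zC eL zL; have TS := hatP_sub TL.
apply/hatPP; split=> [|u].
  exact: subset_trans (subset_trans (subsetDl _ _) (subsetDl _ _)) TS.
rewrite in_setD => /andP[uz /setDP[uT ue]].
have [uC|uC] := boolP (u \in component T x).
  have ueL : u \in T :\: e by rewrite inE ue.
  rewrite (@component_local _ (T :\: e)) ?(hatP_sub eL) ?subsetDl //.
    by have [_ ->] := hatPP _ eL.
  rewrite subsetD component_sub /= -(component_eq uC) in zC *; rewrite disjoint_sym.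
  by apply: disjointWr zC; apply: component_mono; exact: subsetDl.
have uzL : u \in T :\: z by rewrite inE uz.
rewrite setDDl setUC -setDDl (@component_local _ (T :\: z)) ?(hatP_sub zL) ?subsetDl //.
  by have [_ ->] := hatPP _ zL.
rewrite subsetD component_sub /=; have := component_removal_disjoint TS eC uT uC.
by apply: disjointWl; apply: component_mono; exact: subsetDl.
Qed.

(** Inside [component T x] the parity is inherited from [T]; outside it, removing [e] changes
    nothing, so the parity is read off the smaller set. *)
Lemma removal_postponed T x e z : T \in L -> x \in T -> e \subset component T x ->
  [disjoint z & component T x] -> T :\: e :\: z \in L -> T :\: z \in L.
Proof.
move=> TL xT eC zC ezL; have TS := hatP_sub TL.
have zTS : T :\: z \subset Sb by exact: subset_trans (subsetDl _ _) TS.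
apply/hatPP; split=> // u uzT; have /setDP[uT uz] := uzT.
have [uC|uC] := boolP (u \in component T x).
  rewrite (@component_local _ T) ?subsetDl //; first by have [_ ->] := hatPP _ TL.
  by rewrite subsetD component_sub (component_eq uC) disjoint_sym.
have dis : [disjoint component (T :\: z) u & e].
  have := component_removal_disjoint TS eC uT uC.
  by apply: disjointWl; apply: component_mono; exact: subsetDl.
rewrite setDDl setUC -setDDl in ezL.
rewrite -(@component_local (T :\: z :\: e)) ?subsetDl //; last by rewrite subsetD component_sub.
have [_ -> //] := hatPP _ ezL.
rewrite inE uzT andbT; apply: contraTN dis => ue.
by apply/pred0Pn; exists u; rewrite /= ue mem_component.
Qed.

(** The share of the pair in this component is even, nonzero and at most 2. *)
Lemma removal_in_component T y a : T \in L -> y \in L -> y \subset T -> #|T :\: y| = 2 ->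
  a \in T :\: y -> T :\: y \subset component T a.
Proof.
move=> TL yL yT ce; rewrite inE => /andP[ay aT].
have : ~~ odd #|component T a :\: y| := even_componentD yL TL yT aT.
have sub : component T a :\: y \subset T :\: y by apply: setSD; exact: component_sub.
have le2 := subset_leq_card sub; rewrite ce in le2.
have gt0 : 0 < #|component T a :\: y|.
  by apply/card_gt0P; exists a; rewrite inE ay mem_component // hatP_sub.
move=> ev; suff /eqP <- : component T a :\: y == T :\: y by exact: subsetDl.
rewrite eqEcard sub ce; move: ev gt0 le2.
by case: #|_| => [|[|[|]]].
Qed.

End ChordalPoset.

(** * Lexicographic order on sequences of naturals *)

Section Lexicographic.
Implicit Types s t : seq nat.

Fixpoint lexle s t : bool :=
  match s, t with
  | [::], _ => true
  | _ :: _, [::] => false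
  | i :: s', j :: t' => (i < j) || ((i == j) && lexle s' t')
  end.

Definition lexlt s t := ~~ lexle t s.

Lemma lexle_refl : reflexive lexle.
Proof. by elim=> //= i s ->; rewrite eqxx orbT. Qed.

Lemma lexle_total : total lexle.
Proof. by elim=> [|i s ih] [|j t] //=; case: ltngtP => //= ->. Qed.

Lemma lexle_trans : transitive lexle.
Proof.
move=> t s r; elim: s t r => [|i s ih] [|j t] [|l r] //=.
move=> /orP[ij|/andP[/eqP-> st]] /orP[jl|/andP[/eqP<- tr]].
- by rewrite (ltn_trans ij).
- by rewrite ij.
- by rewrite jl.
- by rewrite eqxx (ih _ _ st tr) orbT.
Qed.

Lemma lexle_anti : antisymmetric lexle.
Proof.
by elim=> [|i s ih] [|j t] //=; case: ltngtP => //= -> /ih ->.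
Qed.

Lemma lexlt_irr s : lexlt s s = false.
Proof. by rewrite /lexlt lexle_refl. Qed.

Lemma lexltW s t : lexlt s t -> lexle s t.
Proof. by rewrite /lexlt; case/orP: (lexle_total s t) => ->. Qed.

Lemma lexlt_neqAle s t : lexlt s t = (s != t) && lexle s t.
Proof.
apply/idP/andP => [lt|[ne le]].
  by split; [apply: contraTneq lt => ->; rewrite lexlt_irr|exact: lexltW].
by apply: contra ne => ts; apply/eqP/lexle_anti; rewrite le.
Qed.

Lemma lexle_eqVlt s t : lexle s t = (s == t) || lexlt s t.
Proof. by rewrite lexlt_neqAle; case: eqP => // ->; rewrite lexle_refl. Qed.

Lemma lexle_cat s s' t t' : size s = size s' ->
  lexle (s ++ t) (s' ++ t') = lexlt s s' || (s == s') && lexle t t'.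
Proof.
elim: s s' => [|i s ih] [|j s'] //= [/ih ->].
by rewrite !lexlt_neqAle /= eqseq_cons; case: ltngtP => //=; rewrite andbF.
Qed.

Lemma lexlt_cat s s' t t' : size s = size s' ->
  lexlt (s ++ t) (s' ++ t') = lexlt s s' || (s == s') && lexlt t t'.
Proof.
move=> ss'; rewrite {1}/lexlt lexle_cat // negb_or negb_and eq_sym.
have [<-|ne] := eqVneq s s'; first by rewrite lexlt_irr.
by rewrite andbT orbF [in RHS]/lexlt lexle_eqVlt eq_sym (negbTE ne).
Qed.

Lemma lexlt_le_trans s t r : lexlt s t -> lexle t r -> lexlt s r.
Proof. by move=> st tr; apply: contra st; exact: lexle_trans. Qed.

Lemma lexlt_pair i j i' j' :
  lexlt [:: i; j] [:: i'; j'] = (i < i') || (i == i') && (j < j').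
Proof. by rewrite /lexlt /= andbT; case: ltngtP => //= _; case: ltngtP. Qed.

End Lexicographic.

(** * Step keys and the exchange of removed pairs *)

Section Keys.
Variables (n k : nat) (Sb : {set 'I_n}) (B : {set {set 'I_n}}).
Hypotheses (bB : building_set Sb B) (chB : chordal B).
Implicit Types (T U I K C D X w y e z Z : {set 'I_n}) (u v a b c : 'I_n).
Implicit Types x : nat -> {set 'I_n}.
Local Notation L := (hatP Sb B).
Local Notation conn := (conn B).
Local Notation component := (component B).

(** When [Z] lies in one component of [T], this is the largest element of that component; a maximum
    over all of [Z] avoids choosing a point of it. *)
Definition reach T Z := \max_(v in T | [exists u in Z, conn T u v]) val v.
Definition elements Z := [seq val v | v <- enum Z].
Definition reaches x r Z := [seq reach (x l) Z | l <- iota 0 r.+1].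
Definition step_key x r y := reaches x r (x r :\: y) ++ elements (x r :\: y).
Definition covers T y := [&& y \in L, y \subset T & #|y| + 2 == #|T|].

Lemma elements_pair a b : val a < val b -> elements [set a; b] = [:: val a; val b].
Proof.
move=> ab; rewrite /elements.
suff -> : enum [set a; b] = [:: a; b] by [].
have lt_trans : transitive (fun u v => val u < val v) by move=> ? ? ?; exact: ltn_trans.
apply: (irr_sorted_eq lt_trans) => [u||/=|u].
- exact: ltnn.
- rewrite /enum_mem; apply: sorted_filter => //.
  have := iota_ltn_sorted 0 n; rewrite -val_enum_ord sorted_map enumT; exact.
- by rewrite ab.
- by rewrite mem_enum !inE.
Qed.

Lemma elements_inj : injective elements.
Proof.
move=> Z Z' /(inj_map val_inj) ZZ'; apply/setP => v.
by rewrite -[v \in Z]mem_enum ZZ' mem_enum.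
Qed.

Lemma coversP T y : reflect [/\ y \in L, y \subset T & #|y| + 2 = #|T|] (covers T y).
Proof. by apply: (iffP and3P) => -[? ? /eqP]. Qed.

Lemma card_removed T y : covers T y -> #|T :\: y| = 2.
Proof.
by move=> /coversP[_ yT cT]; rewrite cardsD (setIidPr yT) -cT addKn.
Qed.

Lemma removedK T y : covers T y -> T :\: (T :\: y) = y.
Proof. by move=> /coversP[_ yT _]; rewrite setDDr setDv set0U; exact/setIidPr. Qed.

Lemma removed_pair T y : covers T y -> exists a b, val a < val b /\ T :\: y = [set a; b].
Proof.
move=> /card_removed c2; have [|a [b [ab aX bX _]]] := @two_lowest n (T :\: y).
  by rewrite c2.
exists a, b; split=> //; apply/esym/eqP; rewrite eqEcard subUset !sub1set aX bX c2 cards2.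
by have -> : a != b by apply: contraTneq ab => ->; rewrite ltnn.
Qed.

Lemma removed_in_component T y a : T \in L -> covers T y -> a \in T :\: y ->
  T :\: y \subset component T a.
Proof.
move=> TL cy; have [yL yT _] := coversP _ _ cy.
exact: (removal_in_component bB TL yL yT (card_removed cy)).
Qed.

Lemma reach_le T Z m : (forall u v, u \in Z -> conn T u v -> val v <= m) -> reach T Z <= m.
Proof.
by move=> le; apply/bigmax_leqP => v /andP[_ /exists_inP[u uZ uv]]; exact: le uv.
Qed.

Lemma reach_ge T Z u v : u \in Z -> conn T u v -> val v <= reach T Z.
Proof.
move=> uZ uv; apply: (@leq_bigmax_cond _ _ val v).
by rewrite (conn_memr uv) /=; apply/exists_inP; exists u.
Qed.

(** Makes the label faithful: components of [T] with equal labels share an element and so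
    coincide. *)
Lemma reach_attained T Z u : T \subset Sb -> u \in Z -> u \in T -> Z \subset component T u ->
  exists2 v, v \in component T u & val v = reach T Z.
Proof.
move=> TS uZ uT ZC.
have ne : 0 < #|[pred v in T | [exists u in Z, conn T u v]]|.
  apply/card_gt0P; exists u; rewrite inE uT /=; apply/exists_inP; exists u => //.
  exact: (conn_refl bB).
have [v /andP[vT /exists_inP[u' u'Z u'v]] vE] := eq_bigmax_cond (fun v : 'I_n => val v) ne.
exists v => //; have := subsetP ZC _ u'Z; rewrite !in_component => uu'.
exact: (conn_trans bB) u'v.
Qed.

Definition prefix_chain x r :=
  (forall l, l <= r -> x l \in L) /\ (forall l, l < r -> x l.+1 \subset x l).

Lemma prefix_chain_sub x r l l' : prefix_chain x r -> l <= l' -> l' <= r -> x l' \subset x l.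
Proof.
move=> [_ sub] /subnKC <-; elim: (l' - l) => [|m ih]; first by rewrite addn0.
rewrite addnS => lm; apply: subset_trans (sub _ lm) (ih _); exact: ltnW.
Qed.

(** Components only grow towards the top of the chain, so pairs sharing a component of [x r] share
    one in every earlier [x l]. *)
Lemma reaches_component x r Z Z' u u' v : prefix_chain x r -> u \in Z -> u' \in Z' ->
  Z \subset component (x r) v -> Z' \subset component (x r) v -> reaches x r Z = reaches x r Z'.
Proof.
have half (Y Y' : {set 'I_n}) c c' l : prefix_chain x r -> l <= r -> c' \in Y' ->
    Y \subset component (x r) v -> Y' \subset component (x r) v -> reach (x l) Y <= reach (x l) Y'.
  move=> pc lr c'Y' YC Y'C; apply: reach_le => d d' dY dd'; apply: (reach_ge c'Y').
  have xrl := prefix_chain_sub pc lr (leqnn r).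
  apply: (conn_trans bB) dd'; apply: (conn_mono xrl).
  have := subsetP YC _ dY; have := subsetP Y'C _ c'Y'; rewrite !in_component => vc' vd.
  by apply: (conn_trans bB) vd; rewrite conn_sym.
move=> pc uZ u'Z' ZC Z'C; apply/eq_in_map => l; rewrite mem_iota add0n ltnS => /= lr.
by apply/eqP; rewrite eqn_leq (half Z Z' u u') // (half Z' Z u' u).
Qed.

Lemma reaches_eq_component x r Z Z' u u' : prefix_chain x r ->
  u \in Z -> u' \in Z' -> u \in x r -> u' \in x r ->
  Z \subset component (x r) u -> Z' \subset component (x r) u' ->
  reaches x r Z = reaches x r Z' -> u' \in component (x r) u.
Proof.
move=> pc uZ u'Z' ur u'r ZC Z'C eqr.
have xrS : x r \subset Sb by apply: (hatP_sub bB); have [+ _] := pc; apply.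
have : reach (x r) Z = reach (x r) Z'.
  have := congr1 (fun s => nth 0 s r) eqr.
  by rewrite !(nth_map 0) ?size_iota // nth_iota // add0n.
have [v vC <-] := reach_attained xrS uZ ur ZC.
have [v' v'C <-] := reach_attained xrS u'Z' u'r Z'C => /val_inj vv'.
by rewrite -(component_eq bB vC) vv' (component_eq bB v'C) (mem_component bB).
Qed.

Lemma size_reaches x r Z : size (reaches x r Z) = r.+1.
Proof. by rewrite size_map size_iota. Qed.

Lemma lexlt_step_key x r y y' : lexlt (step_key x r y') (step_key x r y) =
  lexlt (reaches x r (x r :\: y')) (reaches x r (x r :\: y)) ||
  (reaches x r (x r :\: y') == reaches x r (x r :\: y)) &&
    lexlt (elements (x r :\: y')) (elements (x r :\: y)).
Proof. by rewrite lexlt_cat // !size_reaches. Qed.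

Lemma reaches_rcons x r Z : reaches x r.+1 Z = rcons (reaches x r Z) (reach (x r.+1) Z).
Proof. by rewrite /reaches -[r.+2]addn1 iotaD add0n map_cat cats1. Qed.

(* The alternative removes the two lowest of the four elements. *)
Lemma earlier_alternative T y w a b c : T \in L -> covers T y -> covers y w ->
  val a < val b -> T :\: y = [set a; b] -> y :\: w \subset component T a ->
  c \in y :\: w -> val c < val b ->
  exists2 y', covers T y' & [/\ w \subset y', T :\: y' \subset component T a &
    lexlt (elements (T :\: y')) (elements (T :\: y))].
Proof.
move=> TL cy cu ab eE zC cz cb.
have [yL yT cardy] := coversP _ _ cy; have [uL uy cardu] := coversP _ _ cu.
have eC : [set a; b] \subset component T a.
  by rewrite -eE; apply: removed_in_component => //; rewrite eE set21.
have [/setDP[aT ay] /setDP[bT by_]] : a \in T :\: y /\ b \in T :\: y by rewrite eE set21 set22.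
have uT := subset_trans uy yT.
have aCu : a \in component T a :\: w.
  by rewrite inE (subsetP eC) ?set21 // andbT; apply: contra ay; exact: (subsetP uy).
have bCu : b \in component T a :\: w.
  by rewrite inE (subsetP eC) ?set22 // andbT; apply: contra by_; exact: (subsetP uy).
have cCu : c \in component T a :\: w.
  by rewrite inE (subsetP zC) // andbT; case/setDP: cz.
have [|p [q [pq pX qX pqmin]]] := @two_lowest n (component T a :\: w).
  rewrite (cardsD1 a) aCu (cardsD1 b) in_setD1 bCu.
  by have -> : b != a by apply: contraTneq ab => ->; rewrite ltnn.
have [[/setDP[pC pu] /setDP[qC qu]]] := (pX, qX).
have pqT : [set p; q] \subset T.
  by rewrite subUset !sub1set !(subsetP (component_sub B T a)).
have y'T : T :\: (T :\: [set p; q]) = [set p; q].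
  by rewrite setDDr setDv set0U; exact/setIidPr.
exists (T :\: [set p; q]); last split.
- apply/coversP; split; last 1 first.
  + rewrite cardsD (setIidPr pqT) cards2.
    have -> : p != q by apply: contraTneq pq => ->; rewrite ltnn.
    by rewrite subnK // -cardy leq_addl.
  + exact: (remove_lowest bB chB uL TL uT aT pq pX qX pqmin).
  + exact: subsetDl.
- apply/subsetP => v vu; rewrite !inE (subsetP uT) // andbT.
  by apply/norP; split; apply: contraTneq vu => ->.
- by rewrite y'T subUset !sub1set pC qC.
- rewrite y'T eE !elements_pair // /lexlt /=.
  have ca : c != a.
    by apply: contraTneq cz => ->; rewrite inE (negbTE ay) andbF.
  have [pa|pa|] := ltngtP (val a) (val p) => //=.
    case: (pqmin a aCu) => [ap|aq|qa]; move: pa; rewrite ?ap ?aq ?ltnn //.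
      by rewrite ltnNge (ltnW pq).
    by rewrite ltnNge (ltnW (ltn_trans pq qa)).
  move=> /val_inj ap; rewrite negb_or negb_and; have [bq|bq|] := ltngtP (val b) (val q) => //=.
    case: (pqmin c cCu) => [cp|cq|qc].
    - by rewrite cp -ap eqxx in ca.
    - by rewrite cq ltnNge (ltnW bq) in cb.
    - by have := ltn_trans qc cb; rewrite ltnNge (ltnW bq).
  move=> /val_inj bq; case: (pqmin c cCu) => [cp|cq|qc].
  - by rewrite cp -ap eqxx in ca.
  - by rewrite cq bq ltnn in cb.
  - by have := ltn_trans qc cb; rewrite bq ltnn.
Qed.

Lemma prefix_chainW x r r' : r' <= r -> prefix_chain x r -> prefix_chain x r'.
Proof.
move=> rr' [xL xs]; split=> l lr; first by apply: xL; exact: leq_trans rr'.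
by apply: xs; exact: leq_trans rr'.
Qed.

Lemma removed_split T y w v : v \in T :\: w -> v \in (T :\: y) :|: (y :\: w).
Proof. by rewrite !inE => /andP[-> ->]; case: (v \in y). Qed.

Lemma covers_removed T y w : covers T y -> covers y w -> y :\: w \subset T ->
  T :\: (y :\: w) \in L -> covers T (T :\: (y :\: w)).
Proof.
move=> cy cw sub inL; apply/coversP; split=> //; first exact: subsetDl.
rewrite cardsD (setIidPr sub) (card_removed cw) subnK //.
by have [_ _ <-] := coversP _ _ cy; rewrite leq_addl.
Qed.

(* With [alternative_step], the two conditions of a recursive coatom ordering;
   here the order on the coatoms of [x r.+1] depends on the chain above it. *)
Lemma key_step x r w1 w2 : prefix_chain x r.+1 -> covers (x r) (x r.+1) ->
  covers (x r.+1) w1 -> covers (x r.+1) w2 ->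
  (exists y', [/\ covers (x r) y', w1 \subset y' &
     lexlt (step_key x r y') (step_key x r (x r.+1))]) ->
  (forall y', covers (x r) y' -> w2 \subset y' ->
     ~~ lexlt (step_key x r y') (step_key x r (x r.+1))) ->
  lexlt (step_key x r.+1 w1) (step_key x r.+1 w2).
Proof.
move=> pc cy cw1 cw2 [y' [cy' w1y' lt]] noalt.
have pcr := prefix_chainW (leqnSn r) pc.
have TL : x r \in L by have [+ _] := pcr; apply.
have yL : x r.+1 \in L by have [+ _] := pc; apply.
have TS := hatP_sub bB TL.
have [_ yT _] := coversP _ _ cy.
have [a [b [ab eE]]] := removed_pair cy.
have [c [d [cd z1E]]] := removed_pair cw1.
have [c' [d' [cd' z2E]]] := removed_pair cw2.
have ae : a \in x r :\: x r.+1 by rewrite eE set21.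
have be : b \in x r :\: x r.+1 by rewrite eE set22.
have cz : c \in x r.+1 :\: w1 by rewrite z1E set21.
have cz' : c' \in x r.+1 :\: w2 by rewrite z2E set21.
have [/setDP[aT ay] /setDP[bT by_]] := (ae, be).
have [/setDP[cy1 _] /setDP[cy1' _]] := (cz, cz').
have [cT cT'] := (subsetP yT _ cy1, subsetP yT _ cy1').
have eC : x r :\: x r.+1 \subset component (x r) a by exact: removed_in_component.
have z1C : x r.+1 :\: w1 \subset component (x r) c.
  by apply: subset_trans (component_mono _ _ yT); exact: removed_in_component.
have z2C : x r.+1 :\: w2 \subset component (x r) c'.
  by apply: subset_trans (component_mono _ _ yT); exact: removed_in_component.
(* The alternative removes two of the four elements of [x r :\: w1], both from one component. If the
   pairs [x r :\: x r.+1] and [x r.+1 :\: w1] lie in different components, it must remove exactly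
   the latter, whose component is then earlier; otherwise it can precede [{a, b}] only if [c] is
   below [b]. *)
have alpha : lexlt (reaches x r (x r.+1 :\: w1)) (reaches x r (x r :\: x r.+1)) \/
    [/\ reaches x r (x r.+1 :\: w1) = reaches x r (x r :\: x r.+1),
        x r.+1 :\: w1 \subset component (x r) a & val c < val b].
  have [p [q [pq e'E]]] := removed_pair cy'.
  have pe' : p \in x r :\: y' by rewrite e'E set21.
  have qe' : q \in x r :\: y' by rewrite e'E set22.
  have [pT _] := setDP pe'.
  have e'p : x r :\: y' \subset component (x r) p by exact: removed_in_component.
  have e'sub v : v \in x r :\: y' -> v \in (x r :\: x r.+1) :|: (x r.+1 :\: w1).
    move=> /setDP[vT vy']; apply: removed_split; rewrite inE vT andbT.
    by apply: contra vy'; exact: (subsetP w1y').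
  have [cC|cC] := boolP (c \in component (x r) a).
    rewrite (component_eq bB cC) in z1C; right; split=> //.
      exact: reaches_component pcr cz ae z1C eC.
    have e'C : x r :\: y' \subset component (x r) a.
      by apply/subsetP => v /e'sub /setUP[/(subsetP eC)|/(subsetP z1C)].
    move: lt; rewrite lexlt_step_key (reaches_component pcr pe' ae e'C eC) lexlt_irr eqxx /=.
    rewrite e'E eE !elements_pair // lexlt_pair => ltpq.
    rewrite ltnNge; apply/negP => bc.
    have low v : v \in x r :\: y' -> v = a \/ val b <= val v.
      move=> /e'sub; rewrite eE z1E !inE => /orP[]/orP[]/eqP->.
      - by left.
      - by right.
      - by right.
      - by right; exact: leq_trans bc (ltnW cd).
    case/orP: ltpq => [pa|/andP[/eqP pa qb]].
      case: (low p pe') pa => [->|bp pa]; first by rewrite ltnn.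
      by have := leq_ltn_trans bp (ltn_trans pa ab); rewrite ltnn.
    case: (low q qe') => [qa|]; last by rewrite leqNgt qb.
    by move: pq; rewrite qa pa ltnn.
  left; have [pC|pC] := boolP (p \in component (x r) a).
    have e'e : x r :\: y' = x r :\: x r.+1.
      apply/eqP; rewrite eqEcard (card_removed cy) (card_removed cy') leqnn andbT.
      apply/subsetP => v ve'; have /setUP[//|vz1] := e'sub v ve'.
      case/negP: cC; rewrite -(component_eq bB pC) -(component_eq bB (subsetP e'p _ ve')).
      by rewrite (component_eq bB (subsetP z1C _ vz1)) (mem_component bB).
    by move: lt; rewrite -(removedK cy') e'e (removedK cy) lexlt_irr.
  have e'z1 : x r :\: y' = x r.+1 :\: w1.
    apply/eqP; rewrite eqEcard (card_removed cw1) (card_removed cy') leqnn andbT.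
    apply/subsetP => v ve'; have /setUP[ve|//] := e'sub v ve'.
    case/negP: pC; rewrite -(component_eq bB (subsetP eC _ ve)).
    by rewrite (component_eq bB (subsetP e'p _ ve')) (mem_component bB).
  move: lt; rewrite lexlt_step_key e'z1 => /orP[//|/andP[/eqP eqr _]].
  by case/negP: cC; apply: (reaches_eq_component pcr ae cz aT cT eC z1C); rewrite eqr.
(* For [w2] no alternative exists: a pair in another component could have been removed first, and
   [c'] below [b] would let the two lowest elements go first. *)
have beta : lexlt (reaches x r (x r :\: x r.+1)) (reaches x r (x r.+1 :\: w2)) \/
    [/\ reaches x r (x r :\: x r.+1) = reaches x r (x r.+1 :\: w2),
        x r.+1 :\: w2 \subset component (x r) a & val b < val c'].
  have [cC'|cC'] := boolP (c' \in component (x r) a).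
    rewrite (component_eq bB cC') in z2C; right; split=> //.
      exact: reaches_component pcr ae cz' eC z2C.
    rewrite ltnNge leq_eqVlt; apply/norP; split.
      by apply: contraNneq by_ => /val_inj <-.
    apply/negP => cb.
    have [y'' cy'' [w2y'' e''C ltel]] := earlier_alternative TL cy cw2 ab eE z2C cz' cb.
    have [p [q [_ e''E]]] := removed_pair cy''.
    have pe'' : p \in x r :\: y'' by rewrite e''E set21.
    case/negP: (noalt y'' cy'' w2y''); rewrite lexlt_step_key.
    by rewrite (reaches_component pcr pe'' ae e''C eC) eqxx ltel orbT.
  left; have zsub : x r.+1 :\: w2 \subset x r by exact: subset_trans z2C (component_sub _ _ _).
  have dis : [disjoint x r.+1 :\: w2 & component (x r) a].
    apply/pred0P => v /=; apply/negbTE/negP => /andP[/(subsetP z2C) vc va].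
    by case/negP: cC'; rewrite -(component_eq bB va) (component_eq bB vc) (mem_component bB).
  have [w2L _ _] := coversP _ _ cw2.
  have y''L : x r :\: (x r.+1 :\: w2) \in L.
    by apply: (removal_postponed bB TL aT eC dis); rewrite (removedK cy) (removedK cw2).
  have cy'' := covers_removed cy cw2 zsub y''L.
  have e''E : x r :\: (x r :\: (x r.+1 :\: w2)) = x r.+1 :\: w2.
    by rewrite setDDr setDv set0U; exact/setIidPr.
  have w2y'' : w2 \subset x r :\: (x r.+1 :\: w2).
    apply/subsetP => v vw2; rewrite !inE vw2 /=.
    by have [_ /subsetP w2y _] := coversP _ _ cw2; rewrite (subsetP yT) ?w2y.
  have := noalt _ cy'' w2y''; rewrite lexlt_step_key e''E => /norP[].
  rewrite /lexlt negbK lexle_eqVlt => /orP[/eqP eqr _|//].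
  by case/negP: cC'; exact: (reaches_eq_component pcr ae cz' aT cT' eC z2C).
rewrite lexlt_step_key !reaches_rcons -!cats1 lexlt_cat ?size_reaches // eqseq_cat ?size_reaches //.
case: alpha => [lt1|[eq1 z1Ca cb]]; case: beta => [lt2|[eq2 z2Ca bc]].
- by rewrite (lexlt_le_trans lt1 (lexltW lt2)).
- by rewrite -eq2 lt1.
- by rewrite eq1 lt2.
(* Elements of the old component above [c'] remain connected to [c'], because the tail starting at
   [c'] contains neither [a] nor [b]. *)
have reach_le12 : reach (x r.+1) (x r.+1 :\: w1) <= reach (x r.+1) (x r.+1 :\: w2).
  apply: reach_le => v u vz vu.
  have [uc|cu] := leqP (val u) (val c').
    apply: leq_trans uc _; apply: (reach_ge cz').
    by apply: (conn_refl bB) => //; exact: (hatP_sub bB).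
  apply: (reach_ge cz'); apply/connP.
  exists [set i in component (x r) a | val c' <= val i].
  have uC : u \in component (x r) a.
    have vC := subsetP z1Ca _ vz; rewrite -(component_eq bB vC).
    by rewrite in_component; exact: conn_mono vu.
  split.
  - apply: (tail_building bB chB); last exact: (subsetP z2Ca).
    exact: (component_building bB).
  - apply/subsetP => i; rewrite inE => /andP[iC ci].
    have iT := subsetP (component_sub _ _ _) _ iC.
    apply: contraTT ci => iy; have : i \in x r :\: x r.+1 by rewrite inE iy.
    rewrite eE !inE -ltnNge => /orP[] /eqP ->; last by [].
    exact: ltn_trans ab bc.
  - by rewrite inE (subsetP z2Ca) /=.
  - by rewrite inE uC (ltnW cu).
have cc : lexlt (elements (x r.+1 :\: w1)) (elements (x r.+1 :\: w2)).
  by rewrite z1E z2E !elements_pair // lexlt_pair (ltn_trans cb bc).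
rewrite eq1 eq2 lexlt_irr eqxx /= cc andbT /lexlt /= andbT orbC.
by rewrite eqseq_cons andbT; move: reach_le12; case: ltngtP.
Qed.

(** Removes the two lowest elements of [component y v] outside [w]. The bound by [v] is what later
    places the new pair partly below [b]. *)
Lemma exists_cover_avoiding w y v : w \in L -> y \in L -> w \subset y -> v \in y :\: w ->
  exists y' p q,
    [/\ covers y y', w \subset y', y :\: y' = [set p; q] & val p < val q] /\
    ([set p; q] \subset component y v /\ val p <= val v).
Proof.
move=> wL yL wy vyw; have /setDP[vy vw] := vyw; have yS := hatP_sub bB yL.
have vX : v \in component y v :\: w by rewrite inE vw (mem_component bB).
have [|p [q [pq pX qX pqmin]]] := @two_lowest n (component y v :\: w).
  have := even_componentD bB wL yL wy vy; have : 0 < #|component y v :\: w|.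
    by apply/card_gt0P; exists v.
  by case: #|_| => [|[|]].
have [[/setDP[pC pw] /setDP[qC qw]]] := (pX, qX).
have pqC : [set p; q] \subset component y v by rewrite subUset !sub1set pC qC.
have pqy := subset_trans pqC (component_sub _ _ _).
have y'y : y :\: (y :\: [set p; q]) = [set p; q].
  by rewrite setDDr setDv set0U; exact/setIidPr.
exists (y :\: [set p; q]), p, q; split; split=> //.
- apply/coversP; split; last 1 first.
  + rewrite cardsD (setIidPr pqy) cards2.
    have npq : p != q by apply: contraTneq pq => ->; rewrite ltnn.
    by have := subset_leq_card pqy; rewrite cards2 npq => /subnK.
  + exact: (remove_lowest bB chB wL yL wy vy pq pX qX pqmin).
  + exact: subsetDl.
- apply/subsetP => i iw; rewrite !inE (subsetP wy) // andbT.
  by apply/norP; split; apply: contraTneq iw => ->.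
- by case: (pqmin v vX) => [->//|->|/ltnW qv]; rewrite ?(ltnW pq) // (leq_trans (ltnW pq)).
Qed.

(** Hands an alternative over to a cover of [x r.+1] that still contains [w]. In different
    components the two removals commute and [y'] itself serves. In the same component some element
    of its pair is below [b] and still present, so a pair starting no higher can be removed next and
    [earlier_alternative] applies. *)
Lemma alternative_step x r w y' : prefix_chain x r.+1 -> covers (x r) (x r.+1) ->
  w \in L -> w \subset x r.+1 -> covers (x r) y' -> w \subset y' ->
  lexlt (step_key x r y') (step_key x r (x r.+1)) ->
  exists w1, [/\ covers (x r.+1) w1, w \subset w1 &
    exists y'', [/\ covers (x r) y'', w1 \subset y'' &
      lexlt (step_key x r y'') (step_key x r (x r.+1))]].
Proof.
move=> pc cy wL wy cy' wy' lt.
have pcr := prefix_chainW (leqnSn r) pc.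
have TL : x r \in L by have [+ _] := pcr; apply.
have yL : x r.+1 \in L by have [+ _] := pc; apply.
have TS := hatP_sub bB TL.
have [_ yT _] := coversP _ _ cy; have [y'L y'T _] := coversP _ _ cy'.
have [a [b [ab eE]]] := removed_pair cy.
have [a' [b' [ab' e'E]]] := removed_pair cy'.
have ae : a \in x r :\: x r.+1 by rewrite eE set21.
have ae' : a' \in x r :\: y' by rewrite e'E set21.
have be' : b' \in x r :\: y' by rewrite e'E set22.
have [/setDP[aT ay] /setDP[aT' ay']] := (ae, ae').
have eC : x r :\: x r.+1 \subset component (x r) a by exact: removed_in_component.
have e'C' : x r :\: y' \subset component (x r) a' by exact: removed_in_component.
have [aC'|aC'] := boolP (a' \in component (x r) a); last first.
  have dis : [disjoint x r :\: y' & component (x r) a].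
    apply/pred0P => v /=; apply/negbTE/negP => /andP[/(subsetP e'C') vc va].
    by case/negP: aC'; rewrite -(component_eq bB va) (component_eq bB vc) (mem_component bB).
  have e'y : x r :\: y' \subset x r.+1.
    apply/subsetP => v ve'; have /setDP[vT _] := ve'; apply: contraTT ve' => vy.
    apply/negP => ve'; move/pred0P/(_ v): dis; rewrite /= ve' (subsetP eC) //.
    by rewrite inE vy.
  have w1L : x r.+1 :\: (x r :\: y') \in L.
    rewrite -{1}(removedK cy).
    by apply: (removals_commute bB TL aT eC dis); rewrite ?removedK.
  exists (x r.+1 :\: (x r :\: y')); split.
  - apply/coversP; split=> //; first exact: subsetDl.
    rewrite cardsD (setIidPr e'y) (card_removed cy') subnK //.
    by rewrite -(card_removed cy') subset_leq_card.
  - apply/subsetP => v vw; rewrite !inE (subsetP wy) // andbT.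
    by rewrite (subsetP wy').
  - exists y'; split=> //; apply/subsetP => v; rewrite !inE negb_and negbK.
    by move=> /andP[/orP[//|/negP vT] /(subsetP yT)].
rewrite (component_eq bB aC') in e'C'.
move: (lt); rewrite lexlt_step_key (reaches_component pcr ae' ae e'C' eC) lexlt_irr eqxx /=.
rewrite e'E eE !elements_pair // lexlt_pair => ltab.
have [v [ve' vb vy]] : exists v, [/\ v \in x r :\: y', val v < val b & v \in x r.+1].
  have inY v : v \in x r -> v != a -> v != b -> v \in x r.+1.
    move=> vT va vb; apply: contraTT isT => vy.
    by have : v \in x r :\: x r.+1; [rewrite inE vy|rewrite eE !inE (negbTE va) (negbTE vb)].
  have /setDP[bT' _] := be'.
  case/orP: ltab => [aa|/andP[/eqP aa bb]].
    exists a'; split=> //; first exact: ltn_trans ab.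
    by apply: inY => //; rewrite -(inj_eq val_inj) ltn_eqF //; exact: ltn_trans ab.
  exists b'; split=> //; apply: inY => //; rewrite -(inj_eq val_inj); last by rewrite ltn_eqF.
  by rewrite -aa gtn_eqF.
have vyw : v \in x r.+1 :\: w.
  by rewrite inE vy andbT; case/setDP: ve' => _; apply: contra; exact: (subsetP wy').
have [w1 [p [q [[cw1 ww1 zE pq] [pqC pv]]]]] := exists_cover_avoiding wL yL wy vyw.
exists w1; split=> //.
have zC : x r.+1 :\: w1 \subset component (x r) a.
  rewrite zE -(component_eq bB (subsetP e'C' _ ve')).
  by apply: subset_trans pqC (component_mono _ _ yT).
have pz : p \in x r.+1 :\: w1 by rewrite zE set21.
have [y'' cy'' [w1y'' e''C ltel]] :=
  earlier_alternative TL cy cw1 ab eE zC pz (leq_ltn_trans pv vb).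
have [p' [q' [_ e''E]]] := removed_pair cy''.
have pe'' : p' \in x r :\: y'' by rewrite e''E set21.
exists y''; split=> //; rewrite lexlt_step_key.
by rewrite (reaches_component pcr pe'' ae e''C eC) eqxx ltel orbT.
Qed.


Lemma step_key_ext x x' r y : (forall l, l <= r -> x l = x' l) ->
  step_key x r y = step_key x' r y.
Proof.
move=> xx'; rewrite /step_key xx' //; congr (_ ++ _).
by apply/eq_in_map => l; rewrite mem_iota add0n ltnS => /= lr; rewrite xx'.
Qed.

Lemma size_step_key x r y : covers (x r) y -> size (step_key x r y) = r.+3.
Proof.
by move=> cy; rewrite size_cat size_reaches size_map -cardE (card_removed cy) addn2.
Qed.

(** * Maximal chains and their keys *)

Definition full_chain x := x 0 = Sb /\ forall i, i < k -> covers (x i) (x i.+1).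
Definition chain_key x := flatten [seq step_key x i (x i.+1) | i <- iota 0 k].
Definition facet_of x : {set {set 'I_n}} := [set x (val i).+1 | i : 'I_k.-1].

Lemma chain_key_split x j : j < k -> chain_key x =
  flatten [seq step_key x i (x i.+1) | i <- iota 0 j] ++
  step_key x j (x j.+1) ++
  flatten [seq step_key x i (x i.+1) | i <- iota j.+1 (k - j.+1)].
Proof.
move=> jk; rewrite /chain_key -{1}(subnKC (ltnW jk)) iotaD map_cat flatten_cat add0n.
by rewrite -(subnSK jk).
Qed.

(** The size of a step key depends only on its index, so the keys of the two chains have their
    blocks in the same positions. *)
Lemma chain_key_cmp x x' j : j < k -> full_chain x -> full_chain x' ->
  (forall i, i <= j -> x i = x' i) ->
  lexle (chain_key x) (chain_key x') ->
  lexle (step_key x j (x j.+1)) (step_key x' j (x' j.+1)).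
Proof.
move=> jk [_ cx] [_ cx'] xx'; rewrite !(chain_key_split _ jk).
have -> : [seq step_key x i (x i.+1) | i <- iota 0 j] =
    [seq step_key x' i (x' i.+1) | i <- iota 0 j].
  apply/eq_in_map => i; rewrite mem_iota add0n => /= ij; rewrite (xx' i.+1) //.
  by apply: step_key_ext => l li; apply: xx'; exact: leq_trans li (ltnW ij).
have ss : size (step_key x j (x j.+1)) = size (step_key x' j (x' j.+1)).
  by rewrite (size_step_key (cx j jk)) (size_step_key (cx' j jk)).
rewrite lexle_cat // lexlt_irr eqxx orFb andTb (lexle_cat _ _ ss).
by case/orP => [/lexltW//|/andP[/eqP-> _]]; exact: lexle_refl.
Qed.

Hypotheses (SL : Sb \in L) (cardS : #|Sb| = 2 * k) (k2 : 2 <= k).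

Lemma full_chain_mem x i : full_chain x -> i <= k -> x i \in L.
Proof.
move=> [x0 cx]; case: i => [|i] ik; first by rewrite x0.
by have [] := coversP _ _ (cx i ik).
Qed.

Lemma full_chain_card x i : full_chain x -> i <= k -> #|x i| = 2 * (k - i).
Proof.
move=> [x0 cx]; elim: i => [|i ih] ik; first by rewrite x0 subn0.
have [_ _ ci] := coversP _ _ (cx i ik); have := ih (ltnW ik); rewrite -ci -(subnSK ik) mulnS.
by rewrite addnC => /addnI.
Qed.

Lemma full_chain_prefix x r : full_chain x -> r <= k -> prefix_chain x r.
Proof.
move=> fx rk; split=> l lr; first by apply: full_chain_mem => //; exact: leq_trans rk.
by have [_ cx] := fx; have [] := coversP _ _ (cx l (leq_trans lr rk)).
Qed.

Lemma full_chain_sub x i j : full_chain x -> i <= j -> j <= k -> x j \subset x i.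
Proof. by move=> fx ij jk; exact: prefix_chain_sub (full_chain_prefix fx jk) ij (leqnn j). Qed.

(** If no exchange is possible at [x r.+1] alone, [alternative_step] hands the alternative down and
    [key_step] shows that the new cover precedes the actual one, so the interval shortens. Length
    one is impossible: by cardinality the alternative would be the actual step. *)
Lemma exchange_from m x r : full_chain x -> r + m <= k ->
  (exists y', [/\ covers (x r) y', x (r + m) \subset y' &
     lexlt (step_key x r y') (step_key x r (x r.+1))]) ->
  exists j (v : {set 'I_n}), [/\ r <= j, j.+1 < r + m, covers (x j) v, x j.+2 \subset v &
     lexlt (step_key x j v) (step_key x j (x j.+1))].
Proof.
elim: m r => [|[|m] ih] r fx rmk [y' [cy' sub lt]].
- have [_ _ c'] := coversP _ _ cy'; have := subset_leq_card sub.
  by rewrite addn0 -c' addn2 ltnNge leqW // ltnNge.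
- rewrite addn1 in rmk sub; have [_ _ c'] := coversP _ _ cy'.
  have [_ cx] := fx; have [_ _ c] := coversP _ _ (cx r rmk).
  have e : x r.+1 = y'.
    by apply/eqP; rewrite eqEcard sub -(leq_add2r 2) c' c leqnn.
  by rewrite e lexlt_irr in lt.
have rk1 : r.+1 < k by apply: leq_trans rmk; rewrite !addnS ltnS ltnS leq_addr.
have [_ cx] := fx; have cr := cx r (ltnW rk1); have cr1 := cx r.+1 rk1.
have pc : prefix_chain x r.+1 by apply: full_chain_prefix => //; exact: ltnW.
have [/existsP[v /and3P[cv xv ltv]]|noalt] := boolP [exists v : {set 'I_n},
    [&& covers (x r) v, x r.+2 \subset v & lexlt (step_key x r v) (step_key x r (x r.+1))]].
  by exists r, v; split=> //; rewrite !addnS !ltnS leq_addr.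
have wL : x (r + m.+2) \in L by exact: full_chain_mem.
have wr1 : x (r + m.+2) \subset x r.+1.
  by apply: full_chain_sub => //; rewrite !addnS ltnS leqW // leq_addr.
have [w1 [cw1 ww1 alt]] := alternative_step pc cr wL wr1 cy' sub lt.
have ltr1 : lexlt (step_key x r.+1 w1) (step_key x r.+1 (x r.+2)).
  apply: (key_step pc cr cw1 cr1 alt) => y'' cy'' sy''.
  by move: noalt; rewrite negb_exists => /forallP/(_ y''); rewrite cy'' sy''.
have [||j [v [rj jm cv xv ltv]]] := ih r.+1 fx; first by rewrite addSnnS.
  by exists w1; rewrite addSnnS.
by exists j, v; split=> //; [exact: ltnW|rewrite -addSnnS].
Qed.

Lemma full_chain_inj x i j : full_chain x -> i <= k -> j <= k -> x i = x j -> i = j.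
Proof.
move=> fx ik jk xij; have := full_chain_card fx ik; rewrite xij (full_chain_card fx jk).
move=> /eqP; rewrite eqn_mul2l /= => /eqP e.
by rewrite -(subKn ik) -(subKn jk) e.
Qed.

Lemma mem_facet_of x (v : {set 'I_n}) : reflect (exists i, 0 < i < k /\ v = x i) (v \in facet_of x).
Proof.
apply: (iffP imsetP) => [[i _ ->]|[[|i] [/andP[i0 ik] ->]] //].
  by exists (val i).+1; split=> //=; rewrite -ltn_predRL.
have ik' : i < k.-1 by rewrite ltn_predRL.
by exists (Ordinal ik').
Qed.

Lemma card_facet_of x : full_chain x -> #|facet_of x| = k.-1.
Proof.
move=> fx; rewrite card_imset ?card_ord // => i j ij.
have le_k (l : 'I_k.-1) : l.+1 <= k by have := ltn_ord l; rewrite ltn_predRL => /ltnW.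
exact/val_inj/succn_inj/(full_chain_inj fx (le_k i) (le_k j) ij).
Qed.

(** * Facets of the order complex as full chains *)

Local Notation K := (order_complex (proper_part_PB Sb B)).

Lemma order_complexP (T : finType) (P : {set {set T}}) (F : {set {set T}}) :
  reflect [/\ F != set0, F \subset P &
             forall X Y : {set T}, X \in F -> Y \in F -> (X \subset Y) || (Y \subset X)]
          (F \in order_complex P).
Proof.
rewrite inE; apply: (iffP and3P) => -[F0 FP cF]; split=> //.
  by move=> X Y XF YF; exact: (forall_inP (forall_inP cF X XF) Y YF).
by apply/forall_inP => X XF; apply/forall_inP => Y YF; exact: cF.
Qed.

Lemma facetP (V : finType) (C : {set {set V}}) (F : {set V}) :
  reflect (F \in C /\ forall G, G \in C -> F \subset G -> G = F) (F \in facets_cx C).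
Proof.
rewrite inE; apply: (iffP andP) => -[FC mF]; split=> //.
  by move=> G GC FG; have := forall_inP mF G GC; rewrite FG => /eqP.
by apply/forall_inP => G GC; apply/implyP => FG; apply/eqP; exact: mF.
Qed.

Lemma proper_partP (v : {set 'I_n}) : v \in proper_part_PB Sb B ->
  v \in L /\ exists2 i, 0 < i < k & #|v| = 2 * (k - i).
Proof.
rewrite in_setD in_set2 negb_or -!andbA => /and3P[v0 vS vL].
have vSb := hatP_sub bB vL.
split=> //; have := odd_double_half #|v|; rewrite (negbTE (hatP_even bB vL)) add0n => cv.
have hk : #|v|./2 < k.
  rewrite -ltn_double cv -mul2n -cardS; apply: proper_card.
  by rewrite properEneq vS vSb.
have h0 : 0 < #|v|./2 by rewrite -double_gt0 cv card_gt0.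
exists (k - #|v|./2); last by rewrite subKn ?mul2n ?cv // ltnW.
by rewrite subn_gt0 hk /= ltn_subrL h0 (ltn_trans _ k2).
Qed.

Lemma full_chain_proper_part x i : full_chain x -> 0 < i < k -> x i \in proper_part_PB Sb B.
Proof.
move=> fx /andP[i0 ik]; have cx := full_chain_card fx (ltnW ik).
rewrite in_setD full_chain_mem ?(ltnW ik) // andbT in_set2; apply/norP; split.
  by rewrite -card_gt0 cx muln_gt0 subn_gt0.
apply: contraTneq (ik) => xS; move/eqP: cx; rewrite xS cardS eqn_mul2l /= => /eqP kk.
by have : k - i < k; [rewrite ltn_subrL i0 (ltn_trans _ k2)|rewrite -kk ltnn].
Qed.

(** The chain has a member of every cardinality that occurs in the proper part, so an element
    comparable to all of them is one of them. *)
Lemma facet_of_facet x : full_chain x -> facet_of x \in facets_cx K.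
Proof.
move=> fx; apply/facetP; split.
  apply/order_complexP; split.
  - by rewrite -card_gt0 card_facet_of // -subn1 subn_gt0.
  - by apply/subsetP => v /mem_facet_of[i [ik ->]]; exact: full_chain_proper_part.
  - move=> X Y /mem_facet_of[i [/andP[_ ik] ->]] /mem_facet_of[j [/andP[_ jk] ->]].
    by case/orP: (leq_total i j) => ij; rewrite (full_chain_sub fx ij) ?orbT // ltnW.
move=> G /order_complexP[_ GP cG] FG; apply/eqP; rewrite eqEsubset FG andbT.
apply/subsetP => v vG; have [_ [i ik cv]] := proper_partP (subsetP GP _ vG).
have xiF : x i \in facet_of x by apply/mem_facet_of; exists i.
have /andP[_ /ltnW ik'] := ik.
suff -> : v = x i by [].
have cx := full_chain_card fx ik'.
have := cG _ _ vG (subsetP FG _ xiF) => /orP[] s; apply/eqP; last rewrite eq_sym.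
  by rewrite eqEcard s cx cv leqnn.
by rewrite eqEcard s cx cv leqnn.
Qed.

(** Descends from [Sb] by covers that contain every member of [H] smaller than the current set. As
    [H] is a chain, it is enough to stay above the largest such member. *)
Lemma chain_extension (H : {set {set 'I_n}}) : H \subset proper_part_PB Sb B ->
  (forall X Y, X \in H -> Y \in H -> (X \subset Y) || (Y \subset X)) ->
  exists2 x, full_chain x & H \subset facet_of x.
Proof.
move=> HP cH.
have HL h : h \in H -> h \in L by move=> /(subsetP HP)/proper_partP[].
pose below T y := [forall h in H, (#|h| < #|T|) ==> (h \subset y)].
have step T : T \in L -> 0 < #|T| -> below T T -> exists y, covers T y && below T y.
  move=> TL T0 bT.
  (* The empty set is adjoined so that the maximum exists even when no member of [H] is smaller than
     [T]. *)
  have h0 : (set0 \in set0 |: H) && (#|@set0 'I_n| < #|T|) by rewrite in_setU1 eqxx cards0.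
  have [w /andP[wH wT] wmax] := @arg_maxnP _ set0
    (fun h : {set 'I_n} => (h \in set0 |: H) && (#|h| < #|T|)) (fun h : {set 'I_n} => #|h|) h0.
  have wL : w \in L.
    by move: wH; rewrite in_setU1 => /orP[/eqP->|/HL//]; exact: (hatP_set0 bB).
  have wsT : w \subset T.
    move: wH; rewrite in_setU1 => /orP[/eqP->|wH]; first exact: sub0set.
    by have := forall_inP bT w wH; rewrite wT.
  have /subsetPn[v vT vw] : ~~ (T \subset w).
    by apply: contraL wT => /subset_leq_card; rewrite -leqNgt.
  have vTw : v \in T :\: w by rewrite inE vw.
  have [y [_ [_ [[cy wy _ _] _]]]] := exists_cover_avoiding wL TL wsT vTw.
  exists y; rewrite cy; apply/forall_inP => h hH; apply/implyP => hT.
  apply: subset_trans wy; have hw : #|h| <= #|w| by apply: wmax; rewrite in_setU1 hH orbT.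
  move: wH; rewrite in_setU1 => /orP[/eqP w0|wH].
    by move: hw; rewrite w0 cards0 leqn0 cards_eq0 => /eqP ->.
  case/orP: (cH _ _ hH wH) => // wh.
  by have /eqP -> : w == h by rewrite eqEcard wh.
pose next T := odflt set0 [pick y | covers T y && below T y].
have nextP T : T \in L -> 0 < #|T| -> below T T -> covers T (next T) && below T (next T).
  by move=> TL T0 /(step T TL T0)[y py]; rewrite /next; case: pickP => [//|/(_ y)]; rewrite py.
pose x i := iter i next Sb.
have bS : below Sb Sb.
  apply/forall_inP => h /HL hL; apply/implyP => _; exact: (hatP_sub bB).
have inv i : i <= k -> [/\ x i \in L, #|x i| = 2 * (k - i) & below (x i) (x i)].
  elim: i => [|i ih] ik; first by rewrite subn0.
  have [xL cx bx] := ih (ltnW ik).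
  have x0 : 0 < #|x i| by rewrite cx muln_gt0 subn_gt0.
  have /andP[/coversP[nL ns nc] nb] := nextP _ xL x0 bx.
  split=> //; first by apply: (@addIn 2); rewrite nc cx -(subnSK ik) mulnS addnC.
  apply/forall_inP => h hH; apply/implyP => hx; have := forall_inP nb h hH.
  by rewrite -nc (ltn_trans hx) // addn2 ltnS leqnSn.
have fx : full_chain x.
  split=> // i ik; have [xL cx bx] := inv i (ltnW ik).
  have x0 : 0 < #|x i| by rewrite cx muln_gt0 subn_gt0.
  by have /andP[] := nextP _ xL x0 bx.
exists x => //; apply/subsetP => h hH.
have [_ [[|i] /andP[i0 ik] ch]] := proper_partP (subsetP HP _ hH); first by [].
apply/mem_facet_of; exists i.+1; split=> //.
have [xL cx bx] := inv i (ltnW (ltnW ik)); have [_ cx1 _] := inv i.+1 (ltnW ik).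
have x0 : 0 < #|x i| by rewrite cx muln_gt0 subn_gt0 (ltn_trans _ ik).
have /andP[_ nb] := nextP _ xL x0 bx; have := forall_inP nb h hH.
rewrite ch -cx1; have -> : #|x i.+1| < #|x i|.
  by rewrite cx1 cx ltn_mul2l /= ltn_sub2l // (ltn_trans _ ik).
by move=> /= hx; apply/eqP; rewrite eqEcard hx ch cx1 leqnn.
Qed.

(** Recovers a chain from its facet by cardinality. [Sb] is adjoined for index 0; at index [k] the
    search fails on a facet and the default [set0] is the correct value. *)
Definition chain_of (F : {set {set 'I_n}}) i : {set 'I_n} :=
  odflt set0 [pick v : {set 'I_n} in Sb |: F | #|v| == 2 * (k - i)].

Lemma chain_of_facet_of x i : full_chain x -> i <= k -> chain_of (facet_of x) i = x i.
Proof.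
move=> fx ik; have cx := full_chain_card fx ik.
have uniqx (v : {set 'I_n}) : v \in Sb |: facet_of x -> #|v| = 2 * (k - i) -> v = x i.
  have [x0 _] := fx; rewrite in_setU1 => /orP[/eqP->|/mem_facet_of[j [/andP[_ jk] ->]]].
    rewrite -x0 (full_chain_card fx (leq0n k)) => /eqP.
    by rewrite eqn_mul2l /= subn0 => /eqP kk; have := subKn ik; rewrite -kk subnn => <-.
  rewrite (full_chain_card fx (ltnW jk)) => /eqP; rewrite eqn_mul2l /= => /eqP e.
  by rewrite -(subKn ik) -e (subKn (ltnW jk)).
rewrite /chain_of; case: pickP => [v /andP[vF /eqP cv]|none] /=; first exact: uniqx.
have [i0|i0] := posnP i.
  have := none Sb; rewrite in_setU1 eqxx /= i0 subn0 cardS eqxx; by [].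
have [ik'|ki] := ltnP i k.
  have := none (x i); rewrite in_setU1 cx eqxx andbT => /norP[_] /mem_facet_of[].
  by exists i; rewrite i0.
have e : i = k by apply/eqP; rewrite eqn_leq ik.
by move: cx; rewrite e subnn muln0 => /eqP; rewrite cards_eq0 => /eqP ->.
Qed.

Lemma full_chain_ext x x' : full_chain x -> (forall i, i <= k -> x' i = x i) -> full_chain x'.
Proof.
move=> [x0 cx] xx'; split=> [|i ik]; first by rewrite xx'.
by rewrite !xx' ?cx // ltnW.
Qed.

Lemma facet_of_ext x x' : (forall i, i <= k -> x' i = x i) -> facet_of x' = facet_of x.
Proof.
move=> xx'; apply: eq_imset => i /=; apply: xx'.
by rewrite ltnW // -ltn_predRL.
Qed.

Lemma facet_chain F : F \in facets_cx K ->
  full_chain (chain_of F) /\ facet_of (chain_of F) = F.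
Proof.
move=> /facetP[/order_complexP[_ FP cF] Fmax].
have [x fx Fx] := chain_extension FP cF.
have /facetP[xK _] := facet_of_facet fx.
have <- := Fmax _ xK Fx.
have e i : i <= k -> chain_of (facet_of x) i = x i by exact: chain_of_facet_of.
by split; [exact: full_chain_ext e|exact: facet_of_ext e].
Qed.

(** Applies [exchange_from] between the first disagreement of the chains and their next agreement.
    The replaced set lies strictly between the two, where the chains differ at every index, so [x']
    does not contain it. *)
Lemma exchange x x' : full_chain x -> full_chain x' -> facet_of x != facet_of x' ->
  lexle (chain_key x') (chain_key x) ->
  exists x'' (v : {set 'I_n}), [/\ full_chain x'', lexlt (chain_key x'') (chain_key x),
    v \in facet_of x, v \notin facet_of x' & facet_of x :\ v \subset facet_of x''].
Proof.
move=> fx fx' neq le; have [x0 cx] := fx; have [x'0 cx'] := fx'.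
have ex : exists i, (i <= k) && (x i != x' i).
  have [/existsP[i xi]|none] := boolP [exists i : 'I_k.+1, x i != x' i].
    by exists i; rewrite -ltnS ltn_ord.
  case/eqP: neq; apply: facet_of_ext => i ik; apply/eqP; apply: contraNT none => xi.
  by apply/existsP; exists (Ordinal (ik : i < k.+1)).
case: (ex_minnP ex) => -[|r] /andP[rk xr] rmin; first by rewrite x0 x'0 eqxx in xr.
have xx' l : l <= r -> x l = x' l.
  move=> lr; apply/eqP; apply: contraLR (lr) => xl; rewrite -ltnNge.
  by apply: rmin; rewrite xl (leq_trans lr) // ltnW.
have cr' : covers (x r) (x' r.+1) by rewrite xx' // cx'.
have lt : lexlt (step_key x r (x' r.+1)) (step_key x r (x r.+1)).
  rewrite lexlt_neqAle; apply/andP; split; last first.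
    rewrite {1}(step_key_ext _ xx'); apply: chain_key_cmp le => // i /xx'; exact.
  rewrite /step_key eqseq_cat ?size_reaches //; apply: contra xr => /andP[_ /eqP].
  by move=> /elements_inj e; rewrite -(removedK cr') e (removedK (cx r rk)).
have exq : exists q, (r < q <= k) && (x q == x' q).
  exists k; rewrite rk leqnn /=.
  have /eqP := full_chain_card fx (leqnn k); have /eqP := full_chain_card fx' (leqnn k).
  by rewrite subnn muln0 !cards_eq0 => /eqP-> /eqP->.
case: (ex_minnP exq) => q /andP[/andP[rq qk] /eqP xq] qmin.
have [|| j [v [rj jq cv xv ltv]]] := @exchange_from (q - r) x r fx.
- by rewrite subnKC // ltnW.
- exists (x' r.+1); rewrite subnKC ?(ltnW rq) //; split=> //.
  by rewrite xq; exact: full_chain_sub.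
rewrite subnKC ?(ltnW rq) // in jq.
have jk : j.+1 < k by exact: leq_trans qk.
have xj : x j.+1 != x' j.+1.
  apply: contraL jq => /eqP e; rewrite -leqNgt; apply: qmin.
  by rewrite e eqxx ltnS rj (ltnW jk).
pose x'' i := if i == j.+1 then v else x i.
have x''j i : i <= j -> x'' i = x i.
  by move=> ij; rewrite /x'' ltn_eqF.
have x''1 : x'' j.+1 = v by rewrite /x'' eqxx.
have fx'' : full_chain x''.
  split=> [|i ik]; first by rewrite x''j.
  have [->|ij] := eqVneq i j; first by rewrite x''1 x''j.
  have [->|ij1] := eqVneq i j.+1; last by rewrite /x'' eqSS (negbTE ij) (negbTE ij1) cx.
  rewrite x''1 /x'' eqSS -[j.+1 == j](negbK) neq_ltn ltnSn orbT /=.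
  apply/coversP; split=> //; first exact: full_chain_mem.
  have [_ _ c2] := coversP _ _ (cx j.+1 jk); have [_ _ c1] := coversP _ _ (cx j (ltnW jk)).
  have [_ _ c3] := coversP _ _ cv.
  by rewrite c2; apply/eqP; rewrite -(eqn_add2r 2) c1 c3.
exists x'', (x j.+1); split=> //.
- apply: contra ltv => le''.
  have := chain_key_cmp (ltnW jk) fx fx'' (fun i ij => esym (x''j i ij)) le''.
  by rewrite x''1 (step_key_ext _ x''j).
- by apply/mem_facet_of; exists j.+1.
- apply/mem_facet_of => -[i [/andP[_ ik] e]].
  have cj := full_chain_card fx (ltnW jk); have ci := full_chain_card fx' (ltnW ik).
  move: cj; rewrite e ci => /eqP; rewrite eqn_mul2l /= => /eqP e'.
  by move: xj; rewrite e -(subKn (ltnW ik)) e' (subKn (ltnW jk)) eqxx.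
- apply/subsetP => y; rewrite in_setD1 => /andP[yx /mem_facet_of[i [ik yE]]].
  apply/mem_facet_of; exists i; split=> //; rewrite /x''.
  by have /negbTE -> : i != j.+1 by apply: contraNneq yx => ij; rewrite yE ij.
Qed.

Definition facet_le F G := lexle (chain_key (chain_of F)) (chain_key (chain_of G)).
Definition shelling := sort facet_le (enum (facets_cx K)).

Lemma uniq_shelling : uniq shelling.
Proof. by rewrite sort_uniq enum_uniq. Qed.

Lemma mem_shelling F : (F \in shelling) = (F \in facets_cx K).
Proof. by rewrite mem_sort mem_enum. Qed.

Lemma shelling_sorted i j : i <= j -> j < size shelling ->
  facet_le (nth set0 shelling i) (nth set0 shelling j).
Proof.
move=> ij js; have tot : total facet_le by move=> ? ?; exact: lexle_total.
have tr : transitive facet_le by move=> ? ? ?; exact: lexle_trans.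
apply: (sorted_leq_nth tr (fun F => lexle_refl _) set0 (sort_sorted tot _)) => //.
by rewrite inE (leq_ltn_trans ij).
Qed.

Lemma shelling_pure : pure_cx K (k - 2).
Proof.
move=> F /facet_chain[fx <-]; rewrite card_facet_of //.
by rewrite -subSn // subSS subn1.
Qed.

(** A common face of [F] and an earlier facet lies in the ridge [F :\ v], which [facet_of x'']
    covers. For [k = 2] this ridge is the empty face, which [shell_inter] includes. *)
Lemma shelling_shells j : 0 < j < size shelling ->
  pure_dim_pred (shell_inter shelling j) (k - 2).
Proof.
move=> /andP[j0 js]; set F := nth set0 shelling j.
have Fs : F \in shelling by exact: mem_nth.
have [fF eF] := facet_chain (etrans (esym (mem_shelling F)) Fs).
have cF : #|F| = (k - 2).+1 by apply: shelling_pure; rewrite -mem_shelling.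
have earlier F' : F' \in take j shelling -> F' != F.
  move=> F'j; apply: contraTneq F'j => ->; rewrite /F in_take ?mem_nth //.
  by rewrite index_uniq ?uniq_shelling // ltnn.
split=> G; rewrite inE => /andP[GF /hasP[F' F'j GF']].
  have F's := mem_take F'j.
  have cF' : #|F'| = (k - 2).+1 by apply: shelling_pure; rewrite -mem_shelling.
  rewrite -ltnS -cF; apply: proper_card; rewrite properEneq GF andbT.
  apply: contraNneq (earlier F' F'j) => GE; rewrite GE in GF'.
  by rewrite eq_sym eqEcard GF' cF cF' leqnn.
have F's := mem_take F'j; have [fF' eF'] := facet_chain (etrans (esym (mem_shelling F')) F's).
have F'le : facet_le F' F.
  have iF' : index F' shelling < j by rewrite -in_take.
  by rewrite -[F'](nth_index set0 F's); apply: shelling_sorted => //; exact: ltnW.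
have [|x'' [v [fx'' ltx'' vF vF' Fv]]] := exchange fF fF' _ F'le.
  by rewrite eF eF' eq_sym; exact: earlier.
rewrite eF in vF Fv; rewrite eF' in vF'.
have F''s : facet_of x'' \in shelling by rewrite mem_shelling facet_of_facet.
exists (F :\ v); last split.
- rewrite inE subsetDl /=; apply/hasP; exists (facet_of x'') => //.
  rewrite in_take // ltnNge; apply/negP => ji.
  have := shelling_sorted ji; rewrite index_mem nth_index // => /(_ F''s).
  apply/negP; rewrite /facet_le.
  have -> // : chain_key (chain_of (facet_of x'')) = chain_key x''.
  rewrite /chain_key; congr flatten; apply/eq_in_map => i; rewrite mem_iota add0n => /= ik.
  have e l : l <= k -> chain_of (facet_of x'') l = x'' l by exact: chain_of_facet_of.
  by rewrite e //; apply: step_key_ext => l li; apply: e; exact: leq_trans li (ltnW ik).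
- by rewrite subsetD1 GF; apply: contra vF'; exact: (subsetP GF').
- by apply: succn_inj; rewrite -cF (cardsD1 v F) vF add1n.
Qed.

Lemma order_complex_neq0 : K != set0.
Proof.
have [|X Y|x fx _] := @chain_extension set0; rewrite ?sub0set ?inE //.
by apply/set0Pn; exists (facet_of x); case/facetP: (facet_of_facet fx).
Qed.

End Keys.

From mathcomp Require Import all_classical all_reals all_analysis.
From mathcomp Require Import ring lra.
Import numFieldNormedType.Exports.

(** * Shellable complexes are homotopy equivalent to wedges of spheres *)

Section Continuity.
Import Order.TTheory GRing.Theory Num.Theory.
Local Open Scope classical_set_scope.
Local Open Scope ring_scope.
Variables (R : realType) (T : topologicalType).
Implicit Types f g : T -> R.

Lemma fun_cst_continuous (c : R) : continuous (fun _ : T => c).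
Proof. by move=> x; exact: cst_continuous. Qed.

Lemma fun_add_continuous f g :
  continuous f -> continuous g -> continuous (fun x => f x + g x).
Proof. by move=> cf cg x; apply: cvgD; [exact: cf|exact: cg]. Qed.

Lemma fun_opp_continuous f : continuous f -> continuous (fun x => - f x).
Proof. by move=> cf x; apply: cvgN; exact: cf. Qed.

Lemma fun_sub_continuous f g :
  continuous f -> continuous g -> continuous (fun x => f x - g x).
Proof. by move=> cf cg; apply: fun_add_continuous => //; exact: fun_opp_continuous. Qed.

Lemma fun_mul_continuous f g :
  continuous f -> continuous g -> continuous (fun x => f x * g x).
Proof. by move=> cf cg x; apply: cvgM; [exact: cf|exact: cg]. Qed.

Lemma fun_div_continuous f g : (forall x, g x != 0) ->
  continuous f -> continuous g -> continuous (fun x => f x / g x).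
Proof.
by move=> g0 cf cg x; apply: cvgM; [exact: cf|apply: cvgV; [exact: g0|exact: cg]].
Qed.

Lemma fun_min_continuous f g :
  continuous f -> continuous g -> continuous (fun x => Num.min (f x) (g x)).
Proof. by move=> cf cg x; apply: (@continuous_min R T f g x); [exact: cf|exact: cg]. Qed.

Lemma fun_max_continuous f g :
  continuous f -> continuous g -> continuous (fun x => Num.max (f x) (g x)).
Proof. by move=> cf cg x; apply: (@continuous_max R T f g x); [exact: cf|exact: cg]. Qed.

Lemma fun_sum_continuous (I : Type) (r : seq I) (P : pred I) (F : I -> T -> R) :
  (forall i, continuous (F i)) -> continuous (fun x => \sum_(i <- r | P i) F i x).
Proof.
move=> cF; elim: r => [|i r ih].
  have -> : (fun x => \sum_(i <- [::] | P i) F i x) = (fun=> 0).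
    by apply/funext => x; rewrite big_nil.
  exact: fun_cst_continuous.
have -> : (fun x => \sum_(j <- i :: r | P j) F j x) =
    (fun x => if P i then F i x + \sum_(j <- r | P j) F j x
              else \sum_(j <- r | P j) F j x).
  by apply/funext => x; rewrite big_cons.
by case: (P i) => //; apply: fun_add_continuous.
Qed.

Lemma fun_bigmin_continuous (I : Type) (r : seq I) (P : pred I) (F : I -> T -> R) (c : R) :
  (forall i, continuous (F i)) ->
  continuous (fun x => \big[Num.min/c]_(i <- r | P i) F i x).
Proof.
move=> cF; elim: r => [|i r ih].
  have -> : (fun x => \big[Num.min/c]_(i <- [::] | P i) F i x) = (fun=> c).
    by apply/funext => x; rewrite big_nil.
  exact: fun_cst_continuous.
have -> : (fun x => \big[Num.min/c]_(j <- i :: r | P j) F j x) =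
    (fun x => if P i then Num.min (F i x) (\big[Num.min/c]_(j <- r | P j) F j x)
              else \big[Num.min/c]_(j <- r | P j) F j x).
  by apply/funext => x; rewrite big_cons.
by case: (P i) => //; apply: fun_min_continuous.
Qed.

Lemma mx_continuous (m n : nat) (F : T -> 'M[R]_(m, n)) :
  (forall i j, continuous (fun x => F x i j)) -> continuous F.
Proof.
move=> cF x A [P nP sPA].
have : \forall y \near x, forall i, forall j, P i j (F y i j).
  by apply: filter_forall => i; apply: filter_forall => j; apply: cF; exact: nP.
by apply: filterS => y Py; apply: sPA.
Qed.

End Continuity.

(** * Homotopy equivalences from compact quotients *)

Section QuotientEquivalence.
Import Order.TTheory GRing.Theory Num.Theory.
Local Open Scope classical_set_scope.
Local Open Scope ring_scope.

Lemma pair_continuous (T U V : topologicalType) (f : T -> U) (g : T -> V) :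
  continuous f -> continuous g -> continuous (fun x => (f x, g x)).
Proof. by move=> cf cg x; apply: cvg_pair; [exact: cf|exact: cg]. Qed.

Lemma fst_continuous (U V : topologicalType) : continuous (fun q : U * V => q.1).
Proof. by move=> q; exact: cvg_fst. Qed.

Lemma snd_continuous (U V : topologicalType) : continuous (fun q : U * V => q.2).
Proof. by move=> q; exact: cvg_snd. Qed.

Lemma comp_continuous (T U V : topologicalType) (f : T -> U) (g : U -> V) :
  continuous f -> continuous g -> continuous (fun x => g (f x)).
Proof. by move=> cf cg x; apply: (@continuous_comp _ _ _ f g); [exact: cf|exact: cg]. Qed.

Lemma prod_hausdorff (X Y : topologicalType) :
  hausdorff_space X -> hausdorff_space Y -> hausdorff_space (X * Y)%type.
Proof.
move=> hX hY [x y] [x' y'] cl; congr pair.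
- apply: hX => A B nA nB.
  have [[u v] [Au Bu]] := cl (fst @^-1` A) (fst @^-1` B) (cvg_fst nA) (cvg_fst nB).
  by exists u.
- apply: hY => A B nA nB.
  have [[u v] [Au Bu]] := cl (snd @^-1` A) (snd @^-1` B) (cvg_snd nA) (cvg_snd nB).
  by exists v.
Qed.

(** A continuous map from a compact set to a Hausdorff space is closed: the points of [K] that [g]
    sends outside an open set form a compact set, whose image is closed and misses [f x0]. *)
Lemma continuous_through_quotient (X Y Z : topologicalType) (K : set X)
    (f : X -> Y) (g : X -> Z) (h : Y -> Z) :
  compact K -> hausdorff_space Y -> continuous f -> continuous g ->
  (forall x, K x -> h (f x) = g x) -> {within f @` K, continuous h}.
Proof.
move=> cK hY cf cg hfg; apply/subspace_continuousP => _ [x0 Kx0 <-].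
rewrite /from_subspace hfg // => N.
move=> /nbhs_interior nN.
pose C := K `&` g @^-1` (~` N°).
have cC : compact C.
  apply: compact_closedI => //.
  by apply: (proj1 (continuous_closedP g) cg); apply: open_closedC; exact: open_interior.
have clC : closed (f @` C).
  by apply: compact_closed => //; apply: continuous_compact => //; exact: continuous_subspaceT.
have nC : ~ (f @` C) (f x0).
  move=> [x [Kx NNx] fx]; apply: NNx.
  by rewrite -hfg // fx hfg //; exact: nbhs_singleton.
have : nbhs (f x0) (~` (f @` C)).
  by apply: open_nbhs_nbhs; split => //; exact: closed_openC.
apply: filterS => y /= nCy [x Kx xy]; move: nCy; rewrite -{y}xy => nCy.
rewrite /= hfg //; have [Nx|nNx] := pselect (N° (g x)); first exact: interior_subset Nx.
by exfalso; apply: nCy; exists x.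
Qed.

(* The inverse equivalence is [G 1] pushed down to [f @` K]: it is well defined
   because [G 1] is constant on [A], the only fibre of [f] with several points. *)
Lemma quotient_homotopy_equiv (R : realType) (X Y : topologicalType) (K A : set X)
    (f : X -> Y) (G : R * X -> X) (p : X) :
  compact K -> hausdorff_space Y -> A `<=` K ->
  continuous f -> continuous G ->
  (forall (t : R) x, 0 <= t <= 1 -> K x -> K (G (t, x))) ->
  (forall (t : R) x, 0 <= t <= 1 -> A x -> A (G (t, x))) ->
  (forall x, K x -> G (0, x) = x) -> (forall x, A x -> G (1, x) = p) ->
  (forall x x', A x -> A x' -> f x = f x') ->
  (forall x x', K x -> K x' -> f x = f x' -> x = x' \/ A x /\ A x') ->
  homotopy_equiv R K (f @` K).
Proof.
move=> cK hY sAK cf cG GK GA G0 G1 fA finj.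
have xs (y : Y) : exists x, (f @` K) y -> K x /\ f x = y.
  by have [[x Kx <-]|ny] := pselect ((f @` K) y); [exists x|exists p => /ny].
pose s y := projT1 (cid (xs y)).
have sP y : (f @` K) y -> K (s y) /\ f (s y) = y by rewrite /s; case: cid.
have sf x : K x -> s (f x) = x \/ A (s (f x)) /\ A x.
  move=> Kx; have [Ks fs] := sP (f x) (ex_intro2 _ _ x Kx erefl).
  exact: finj.
have i01 : 0 <= (1 : R) <= 1 by rewrite ler01 lexx.
pose g y := G (1, s y).
have gf x : K x -> g (f x) = G (1, x).
  by rewrite /g => /sf [->//|[As Ax]]; rewrite !G1.
have fGs t x : 0 <= t <= 1 -> K x -> f (G (t, s (f x))) = f (G (t, x)).
  by move=> t01 /sf [->//|[As Ax]]; apply: fA; apply: GA.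
have rev (t : R) : 0 <= t <= 1 -> 0 <= 1 - t <= 1.
  by move=> /andP[t0 t1]; rewrite subr_ge0 t1 lerBlDr lerDl.
have cGr : continuous (fun q : R * X => G (1 - q.1, q.2)).
  apply: (comp_continuous (f := fun q : R * X => (1 - q.1, q.2))) => //.
  apply: pair_continuous; last exact: snd_continuous.
  by apply: fun_sub_continuous; [exact: fun_cst_continuous|exact: fst_continuous].
exists f, g; split; last split.
- split; first exact: continuous_subspaceT.
  + by [].
  + apply: (@continuous_through_quotient _ _ _ K f (fun x => G (1, x))) => // x.
    apply: (comp_continuous (f := fun x : X => (1 : R, x))) => //.
    by apply: pair_continuous; [exact: fun_cst_continuous|move=> ?; exact: cvg_id].
  + by move=> _ [_ [x Kx <-] <-]; rewrite gf //; exact: GK.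
(* Time is reversed because a homotopy must end, not start, at the identity. *)
- exists (fun q => G (1 - q.1, q.2)); split.
  + exact: continuous_subspaceT.
  + by move=> [t x] /= /rev t01 Kx; exact: GK.
  + by move=> x Kx /=; rewrite subr0 subrr G0 // gf.
- exists (fun q => f (G (1 - q.1, s q.2))); split.
  (* The cylinder over the image is itself the image of a compact cylinder, so the quotient argument
     applies again. *)
  + have -> : [set q : R * Y | 0 <= q.1 <= 1 /\ (f @` K) q.2] =
        (fun q : R * X => (q.1, f q.2)) @` (`[0, 1] `*` K).
      apply/seteqP; split=> [[t y] /= [t01 [x Kx <-]]|_ [[t x] [/= t01 Kx] <-]] /=.
        by exists (t, x) => //; split => //=; rewrite in_itv.
      by move: t01; rewrite in_itv => /= t01; split => //; exists x.
    apply: (@continuous_through_quotient _ _ _ _ _ (fun q : R * X => f (G (1 - q.1, q.2)))).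
    * by apply: compact_setX => //; exact: segment_compact.
    * by apply: prod_hausdorff => //; exact: Rhausdorff.
    * apply: pair_continuous; first exact: fst_continuous.
      by apply: comp_continuous => //; exact: snd_continuous.
    * exact: comp_continuous cGr cf.
    * by move=> [t x] /= [/=]; rewrite in_itv /= => /rev t01 Kx; exact: fGs.
  + move=> [t _] /= /rev t01 [x Kx <-]; rewrite fGs //.
    by exists (G (1 - t, x)) => //; exact: GK.
  + move=> _ [x Kx <-] /=; rewrite subr0 subrr /g; split => //.
    by have [Ks fs] := sP (f x) (ex_intro2 _ _ x Kx erefl); rewrite G0.
Qed.

End QuotientEquivalence.

(** * Realizations in barycentric coordinates *)

Section Realization.
Import Order.TTheory GRing.Theory Num.Theory.
Local Open Scope classical_set_scope.
Local Open Scope ring_scope.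
Variables (R : realType) (V : finType).
Local Notation pt := 'rV[R]_#|V|.
Implicit Types (x y : pt) (K : {set {set V}}) (F G : {set V}).

Definition bary x (v : V) : R := x ord0 (enum_rank v).
Definition point_of (c : V -> R) : pt := \row_i c (enum_val i).
Definition supp x : {set V} := [set v | bary x v != 0]%SET.

Lemma bary_point_of c v : bary (point_of c) v = c v.
Proof. by rewrite /bary mxE enum_rankK. Qed.

Lemma bary_inj x y : (forall v, bary x v = bary y v) -> x = y.
Proof.
by move=> xy; apply/rowP => i; have := xy (enum_val i); rewrite /bary enum_valK.
Qed.

Lemma point_of_continuous (T : topologicalType) (c : T -> V -> R) :
  (forall v, continuous (fun z => c z v)) -> continuous (fun z => point_of (c z)).
Proof.
move=> cc; apply: mx_continuous => i j.
have -> : (fun z => point_of (c z) i j) = (fun z => c z (enum_val j)).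
  by apply/funext => z; rewrite mxE.
exact: cc.
Qed.

Lemma bary_continuous v : continuous (bary^~ v).
Proof. exact: coord_continuous. Qed.

Lemma in_supp x v : (v \in supp x) = (bary x v != 0).
Proof. by rewrite inE. Qed.

Lemma geomP K x : geom_realization R K x <->
  [/\ forall v, 0 <= bary x v, \sum_v bary x v = 1 & supp x \in K].
Proof.
have sumE : \sum_v bary x v = \sum_i x ord0 i.
  by rewrite (reindex (@enum_val V V)) /=;
    [apply: eq_bigr => i _; rewrite /bary enum_valK|apply: onW_bij; exact: enum_val_bij].
split=> [[x0 [x1 xK]]|[x0 x1 xK]].
  by split=> //; [move=> v; exact: x0|rewrite sumE].
split; [|split => //]; last by rewrite -sumE.
by move=> i; have := x0 (enum_val i); rewrite /bary enum_valK.
Qed.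

Lemma supp_neq0 x : \sum_v bary x v = 1 -> supp x != finset.set0.
Proof.
move=> x1; apply/eqP => s0; move: x1; rewrite big1 => [|v _].
  by move/eqP; rewrite eq_sym oner_eq0.
by apply/eqP; rewrite -[_ == 0]negbK -in_supp s0 finset.in_set0.
Qed.

Lemma bary_le1 K x v : geom_realization R K x -> bary x v <= 1.
Proof.
move=> /geomP[x0 <- _]; rewrite (bigD1 v) //= lerDl.
by apply: sumr_ge0 => w _; exact: x0.
Qed.

Definition down_closed K :=
  forall F G, F \in K -> G \subset F -> G != finset.set0 -> G \in K.

(** Coordinates nonzero at [x] stay nonzero nearby, so a limit point has its support inside a face
    of [K]; downward closure finishes. *)
Lemma geom_realization_compact K :
  down_closed K -> compact (geom_realization R K).
Proof.
move=> dK.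
have cube : compact [set x : pt | forall i, `[0, 1]%classic (x ord0 i)].
  by apply: (@rV_compact R #|V| (fun=> `[0, 1]%classic)) => i; exact: segment_compact.
rewrite (_ : geom_realization R K =
  [set x : pt | forall i, `[0, 1]%classic (x ord0 i)] `&` geom_realization R K).
  apply: compact_closedI => //.
  have clS (C : set pt) : closed C -> geom_realization R K `<=` C ->
      closure (geom_realization R K) `<=` C.
    by move=> clC KC; rewrite (closure_id C).1 //; exact: closure_subset.
  suff clK (x : pt) : closure (geom_realization R K) x -> geom_realization R K x.
    by move=> x; exact: clK.
  move=> clx.
  have x1 : \sum_v bary x v = 1.
    apply: (clS [set x | \sum_v bary x v = 1] _ _ x clx); last by move=> y /geomP[_ y1 _]; exact: y1.
    have cs : continuous (fun x : pt => \sum_v bary x v).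
      by apply: fun_sum_continuous => v; exact: bary_continuous.
    exact: (proj1 (continuous_closedP _) cs [set r : R | r = 1]) (@closed_eq R 1).
  apply/geomP; split => //.
    move=> v; apply: (clS [set x | 0 <= bary x v] _ _ x clx); last by move=> y /geomP[y0 _ _]; exact: y0.
    exact: (proj1 (continuous_closedP _) (@bary_continuous v) [set r : R | 0 <= r]) (@closed_ge R 0).
  have : \forall y \near x, forall v, v \in supp x -> bary y v != 0.
    apply: (@filter_forall _ V (fun v (y : pt) => v \in supp x -> bary y v != 0) _ (nbhs_filter x)) => v.
    case: (boolP (v \in supp x)) => [vx|_]; last first.
      by apply: (@filterE _ _ (nbhs_filter x)).
    rewrite in_supp in vx.
    have : nbhs (bary x v) [set r : R | r != 0].
      by apply: open_nbhs_nbhs; split => //; exact: open_neq.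
    move=> /(@bary_continuous v x); apply: (@filterS _ _ (nbhs_filter x)) => y.
    by move=> yv _; exact: yv.
  move=> /clx [y [/geomP[_ _ yK] yx]]; apply: dK yK _ (supp_neq0 x1).
  by apply/fintype.subsetP => v /yx; rewrite in_supp.
apply/seteqP; split=> [x Kx|x []//]; split=> // i /=.
have [x0 _ _] := (geomP K x).1 Kx.
have := x0 (enum_val i); have := bary_le1 (enum_val i) Kx.
by rewrite /bary enum_valK in_itv /= => -> ->.
Qed.

(** The homotopy is continuous on the whole space and starts at the identity everywhere: it will be
    applied at time 0 to points that have not yet reached the realization of [K]. *)
Definition contractible_cx K :=
  exists (H : R * pt -> pt) (p : pt),
    [/\ continuous H, forall x, H (0, x) = x,
        forall (t : R) x, 0 <= t <= 1 ->
          geom_realization R K x -> geom_realization R K (H (t, x)) &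
        forall x, geom_realization R K x -> H (1, x) = p].

Lemma simplex_contractible K F : F != finset.set0 ->
  (forall G, G \in K = (G \subset F) && (G != finset.set0)) -> contractible_cx K.
Proof.
move=> /finset.set0Pn[u uF] KE.
pose c (q : R * pt) v := (1 - q.1) * bary q.2 v + q.1 * (v == u)%:R.
exists (fun q => point_of (c q)), (point_of (fun v => (v == u)%:R)); split.
- apply: point_of_continuous => v; apply: fun_add_continuous.
    apply: fun_mul_continuous.
      by apply: fun_sub_continuous; [exact: fun_cst_continuous|exact: fst_continuous].
    exact: (comp_continuous (@snd_continuous _ _) (@bary_continuous v)).
  by apply: fun_mul_continuous; [exact: fst_continuous|exact: fun_cst_continuous].
- by move=> x; apply: bary_inj => v; rewrite bary_point_of /c /= subr0 mul1r mul0r addr0.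
- move=> t x /andP[t0 t1] /geomP[x0 x1]; rewrite KE => /andP[xF _].
  have y1 : \sum_v bary (point_of (c (t, x))) v = 1.
    under eq_bigr do rewrite bary_point_of /c /=.
    rewrite big_split /= -!mulr_sumr x1 (bigD1 u) //= eqxx big1 => [|v /negbTE->//].
    by rewrite addr0 !mulr1 subrK.
  apply/geomP; split => //.
    by move=> v; rewrite bary_point_of /c /= addr_ge0 // mulr_ge0 ?subr_ge0.
  rewrite KE supp_neq0 // andbT; apply/fintype.subsetP => v.
  rewrite in_supp bary_point_of /c /=; apply: contra_neqT => vF.
  have /negbTE -> : v != u by apply: contraNneq vF => ->.
  have /eqP -> : bary x v == 0.
    by rewrite -[_ == 0]negbK -in_supp (contra (fintype.subsetP xF v)).
  by rewrite !mulr0 addr0.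
- move=> x _; apply: bary_inj => v.
  by rewrite !bary_point_of /c /= subrr mul0r add0r mul1r.
Qed.

(** On a realization coordinates are at most 1, so the default 1 does not disturb the minimum over a
    nonempty [A]. *)
Definition min_bary (A : {set V}) x : R := \big[Num.min/1]_(v in A) bary x v.

Lemma min_bary_continuous A : continuous (min_bary A).
Proof. by apply: fun_bigmin_continuous => v; exact: bary_continuous. Qed.

Lemma min_bary_le (A : {set V}) x v : v \in A -> min_bary A x <= bary x v.
Proof. by move=> vA; apply: bigmin_le_cond. Qed.

Lemma min_bary_or (A : {set V}) x :
  min_bary A x = 1 \/ exists2 v, v \in A & min_bary A x = bary x v.
Proof.
rewrite /min_bary; apply: (big_rec (fun m => m = 1 \/ exists2 v, v \in A & m = bary x v)).
  by left.
move=> v r vA [->|[u uA ->]]; rewrite /Num.min; case: ifP => _.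
- by right; exists v.
- by left.
- by right; exists v.
- by right; exists u.
Qed.

Lemma min_bary_attained K (A : {set V}) x : geom_realization R K x ->
  A != finset.set0 -> exists2 v, v \in A & min_bary A x = bary x v.
Proof.
move=> Kx /finset.set0Pn[w wA].
have [m1|//] := min_bary_or A x; exists w => //.
by apply/eqP; rewrite eq_le min_bary_le //= m1 (bary_le1 w Kx).
Qed.

Lemma min_bary_gt0 K (A : {set V}) x : geom_realization R K x ->
  (0 < min_bary A x) = (A \subset supp x).
Proof.
move=> Kx; have [x0 _ _] := (geomP K x).1 Kx.
have [->|A0] := eqVneq A finset.set0.
  by rewrite finset.sub0set /min_bary big_pred0 ?ltr01 // => v; rewrite finset.in_set0.
apply/idP/fintype.subsetP => [m0 v vA|As].
  by rewrite in_supp gt_eqF // (lt_le_trans m0) // min_bary_le.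
have [v vA ->] := min_bary_attained Kx A0.
by rewrite lt_neqAle x0 andbT eq_sym -in_supp As.
Qed.

Lemma min_bary_ge0 K (A : {set V}) x : geom_realization R K x -> 0 <= min_bary A x.
Proof.
move=> Kx; have [->|A0] := eqVneq A finset.set0.
  by rewrite /min_bary big_pred0 ?ler01 // => v; rewrite finset.in_set0.
have [v _ ->] := min_bary_attained Kx A0.
by have [x0 _ _] := (geomP K x).1 Kx; exact: x0.
Qed.

(* The faces of [F] not already in [K0] are those containing [A]. Subtracting
   the smallest coordinate on [A] and giving the mass to a vertex [u] of [F]
   outside [A] retracts [|K1|] onto [|K0|]; the formula is global because that
   minimum vanishes on [|K0|]. *)
Lemma contractible_cx_collapse K0 K1 F (A : {set V}) u :
  down_closed K0 -> (forall G, G \in K0 -> ~~ (A \subset G)) ->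
  (forall G, G \in K1 = (G \in K0) || ((G \subset F) && (G != finset.set0))) ->
  A \subset F -> A != finset.set0 -> u \in F -> u \notin A ->
  (forall v, v \in A -> (F :\ v)%SET \in K0) ->
  contractible_cx K0 -> contractible_cx K1.
Proof.
move=> dK0 AK0 K1E AF A0 uF uA FvK0 [H [p [cH H0 HK H1]]].
have K01 x : geom_realization R K0 x -> geom_realization R K1 x.
  by move=> /geomP[x0 x1 xK]; apply/geomP; split=> //; rewrite K1E xK.
(* Each vertex of [A] loses one unit and [u] gains all of them, which keeps the total mass. *)
pose w v : R := #|A|%:R * (v == u)%:R - (v \in A)%:R.
have sw : \sum_v w v = 0.
  rewrite sumrB -mulr_sumr (bigD1 u) //= eqxx big1 => [|v /negbTE->//].
  apply/eqP; rewrite addr0 mulr1 subr_eq0 -sum1_card natr_sum big_mkcond /=; apply/eqP.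
  by apply: eq_bigr => v _; case: (v \in A).
pose c (q : R * pt) v := bary q.2 v + q.1 * min_bary A q.2 * w v.
pose r q := point_of (c q).
have cr : continuous r.
  apply: point_of_continuous => v; apply: fun_add_continuous.
    exact: (comp_continuous (@snd_continuous _ _) (@bary_continuous v)).
  apply: fun_mul_continuous; last exact: fun_cst_continuous.
  apply: fun_mul_continuous; first exact: fst_continuous.
  exact: (comp_continuous (@snd_continuous _ _) (@min_bary_continuous A)).
have r0 t x : t * min_bary A x = 0 -> r (t, x) = x.
  by move=> m0; apply: bary_inj => v; rewrite bary_point_of /c /= m0 mul0r addr0.
have m0 x : geom_realization R K1 x -> supp x \in K0 -> min_bary A x = 0.
  move=> Kx /AK0; rewrite -(min_bary_gt0 A Kx) -leNgt => m0.
  by apply/eqP; rewrite eq_le m0 (min_bary_ge0 A Kx).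
have rsum t x : geom_realization R K1 x -> \sum_v bary (r (t, x)) v = 1.
  move=> /geomP[_ x1 _]; under eq_bigr do rewrite bary_point_of /c /=.
  by rewrite big_split /= -mulr_sumr sw mulr0 addr0.
have rpos (t : R) x v : 0 <= t <= 1 -> geom_realization R K1 x -> 0 <= bary (r (t, x)) v.
  move=> /andP[t0 t1] Kx; have [x0 _ _] := (geomP K1 x).1 Kx.
  have mx := min_bary_ge0 A Kx.
  rewrite bary_point_of /c /= /w; case: (boolP (v \in A)) => vA.
    have /negbTE -> : v != u by apply: contraNneq uA => <-.
    rewrite mulr0 sub0r mulrN1 subr_ge0 (le_trans _ (min_bary_le x vA)) //.
    by rewrite ler_piMl.
  rewrite subr0 addr_ge0 // mulr_ge0 // ?mulr_ge0 //.
have rK1 (t : R) x : 0 <= t <= 1 -> geom_realization R K1 x -> geom_realization R K1 (r (t, x)).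
  move=> t01 Kx; have [x0 x1 xK] := (geomP K1 x).1 Kx.
  have [m0x|m0x] := eqVneq (min_bary A x) 0; first by rewrite r0 // m0x mulr0.
  apply/geomP; split; [by move=> v; exact: rpos|exact: rsum|].
  rewrite K1E; apply/orP; right; rewrite supp_neq0 ?rsum // andbT.
  have xF : supp x \subset F.
    by move: xK; rewrite K1E => /orP[/m0 m0'|/andP[]//]; rewrite m0' ?eqxx // in m0x.
  apply/fintype.subsetP => v; rewrite in_supp bary_point_of /c /=; apply: contra_neqT => vF.
  have /eqP -> : bary x v == 0.
    by rewrite -[_ == 0]negbK -in_supp (contra (fintype.subsetP xF v)).
  rewrite /w; have /negbTE -> : v != u by apply: contraNneq vF => ->.
  by rewrite (negbTE (contra (fintype.subsetP AF v) vF)) mulr0 subr0 mulr0 addr0.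
have rK0 x : geom_realization R K1 x -> geom_realization R K0 (r (1, x)).
  move=> Kx; have i01 : 0 <= (1 : R) <= 1 by rewrite ler01 lexx.
  have [x0 x1 xK] := (geomP K1 x).1 Kx.
  have [s0 s1 sK] := (geomP _ _).1 (rK1 1 x i01 Kx).
  apply/geomP; split => //.
  have [xK0|xK0] := boolP (supp x \in K0).
    by rewrite r0 // m0 // mulr0.
  have xF : supp x \subset F by move: xK; rewrite K1E (negbTE xK0) => /andP[].
  (* A vertex of [A] with least coordinate leaves the support, so the image lies in the face
     [F :\ v]. *)
  have [v vA mv] := min_bary_attained Kx A0.
  apply: dK0 (FvK0 v vA) _ (supp_neq0 s1).
  rewrite finset.subsetD1; apply/andP; split.
    move: sK; rewrite K1E => /orP[|/andP[]//] sK0.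
    apply/fintype.subsetP => z; rewrite in_supp bary_point_of /c /=; apply: contra_neqT => zF.
    have /eqP -> : bary x z == 0.
      by rewrite -[_ == 0]negbK -in_supp (contra (fintype.subsetP xF z)).
    rewrite /w; have /negbTE -> : z != u by apply: contraNneq zF => ->.
    by rewrite (negbTE (contra (fintype.subsetP AF z) zF)) mulr0 subr0 mulr0 addr0.
  rewrite in_supp negbK bary_point_of /c /= mul1r mv /w vA.
  have /negbTE -> : v != u by apply: contraNneq uA => <-.
  by rewrite mulr0 sub0r mulrN1 subrr.
(* The retraction runs up to time 1/2, then the contraction; the clamps freeze each outside its own
   half. *)
pose h (q : R * pt) := H (Num.max 0 (2 * q.1 - 1), r (Num.min 1 (2 * q.1), q.2)).
exists h, p; split.
- apply: (comp_continuous _ cH); apply: pair_continuous.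
    apply: fun_max_continuous; first exact: fun_cst_continuous.
    apply: fun_sub_continuous; last exact: fun_cst_continuous.
    by apply: fun_mul_continuous; [exact: fun_cst_continuous|exact: fst_continuous].
  apply: (comp_continuous _ cr); apply: pair_continuous; last exact: snd_continuous.
  apply: fun_min_continuous; first exact: fun_cst_continuous.
  by apply: fun_mul_continuous; [exact: fun_cst_continuous|exact: fst_continuous].
- move=> x; rewrite /h /= mulr0 sub0r max_l ?oppr_le0 // min_r // H0 r0 //.
  by rewrite mul0r.
- move=> t x /andP[t0 t1] Kx; rewrite /h /=.
  have [t2|/ltW t2] := leP (2 * t) 1.
    by rewrite max_l ?subr_le0 // H0; apply: rK1 => //; rewrite mulr_ge0.
  apply: K01; apply: HK; last exact: rK0.
  by rewrite le_max lexx /= ge_max ler01 /=; lra.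
- move=> x Kx; rewrite /h /= mulr1 min_l ?ler1n // max_r ?subr_ge0 ?ler1n //.
  have -> : 2 - 1 = 1 :> R by lra.
  by rewrite H1 //; exact: rK0.
Qed.

End Realization.

(** * Postponing facets of a shelling *)

Section ShellingSplit.
Import Order.TTheory GRing.Theory Num.Theory.
Local Open Scope ring_scope.
Variables (R : realType) (V : finType) (d : nat).
Implicit Types (K : {set {set V}}) (F G : {set V}) (s : seq {set V}).

Definition generated_cx s : {set {set V}} :=
  [set G : {set V} | (G != finset.set0) && has (fun F : {set V} => G \subset F) s]%SET.

Lemma generated_cx_rcons s F G : (G \in generated_cx (rcons s F)) =
  (G \in generated_cx s) || ((G \subset F) && (G != finset.set0)).
Proof.
by rewrite !inE has_rcons; case: (G == _); rewrite /= ?andbF ?andbT // orbC.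
Qed.

(* The facets of a shelling all of whose boundary is covered by earlier facets
   can be postponed to the end: the other ones form a collapsible complex. *)
Lemma shelling_split s : uniq s -> (0 < size s)%N ->
  (forall F, F \in s -> #|F| = d.+1) ->
  (forall j, (0 < j < size s)%N -> pure_dim_pred (shell_inter s j) d) ->
  exists (K0 : {set {set V}}) (hs : seq {set V}),
    [/\ down_closed K0, contractible_cx R K0 & K0 != finset.set0] /\
    [/\ uniq hs,
        forall F, F \in hs -> #|F| = d.+1 /\ F \notin K0,
        forall F G, F \in hs -> G \subset F -> G != finset.set0 -> G != F -> G \in K0 &
        forall G, (G \in generated_cx s) = (G \in K0) || (G \in hs)].
Proof.
elim/last_ind: s => [//|s F ih] us _ cards shell.
have cardF : #|F| = d.+1 by apply: cards; rewrite mem_rcons mem_head.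
have F0 : F != finset.set0 by rewrite -finset.card_gt0 cardF.
have cardFv v : v \in F -> #|(F :\ v)%SET| = d.
  by move=> vF; apply: succn_inj; rewrite -cardF (finset.cardsD1 v F) vF add1n.
have [s0|s0] := posnP (size s).
  move: s0 us cards shell => /size0nil -> _ _ _ /=.
  exists (generated_cx [:: F]), [::]; split; split=> //.
  - by move=> G G'; rewrite !inE /= !orbF => /andP[_ GF] GG' ->; exact: fintype.subset_trans GF.
  - by apply: (@simplex_contractible R V _ F F0) => G; rewrite !inE /= orbF andbC.
  - by apply/finset.set0Pn; exists F; rewrite !inE /= F0 subxx.
  - by move=> G; rewrite in_nil orbF.
move: us; rewrite rcons_uniq => /andP[Fs us].
have cardS G : G \in s -> #|G| = d.+1.
  by move=> Gs; apply: cards; rewrite mem_rcons inE Gs orbT.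
have [|K0 [hs [[dK0 cK0 K00] [uhs hs1 hs2 genE]]]] := ih us s0 cardS.
  move=> j /andP[j0 js]; have := shell j; rewrite size_rcons j0 ltnS (ltnW js).
  rewrite /shell_inter nth_rcons js -cats1 takel_cat ?(ltnW js) //; exact.
have Fgen : F \notin generated_cx s.
  rewrite inE F0 /=; apply/hasPn => G Gs; apply: contraNN Fs => FG.
  suff -> : F = G by [].
  by apply/eqP; rewrite finset.eqEcard FG /= cardF (cardS _ Gs) leqnn.
have Fhs : F \notin hs by apply: contraNN Fgen => Fhs; rewrite genE Fhs orbT.
have FK0 : F \notin K0 by apply: contraNN Fgen => FK0; rewrite genE FK0.
(* A postponed facet contributes only itself; all its proper faces are in [K0]. So earlier
   postponements never remove part of the boundary that a later facet needs. *)
have inK0 G : G \in generated_cx s -> #|G| != d.+1 -> G \in K0.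
  by rewrite genE => /orP[//|/hs1[->]]; rewrite eqxx.
(* The vertices whose opposite ridge is already covered. By purity of the intersection, a face of
   [F] is covered exactly when it misses one of them. *)
pose A : {set V} := [set v in F | has (fun F' : {set V} => (F :\ v)%SET \subset F') s]%SET.
have AF : A \subset F by apply/fintype.subsetP => v; rewrite inE => /andP[].
have Anew G : G \subset F -> has (fun F' : {set V} => G \subset F') s ->
    exists2 v, v \in A & v \notin G.
  move=> GF Gs; have := shell (size s); rewrite size_rcons s0 leqnn => /(_ isT)[_].
  have -> : shell_inter (rcons s F) (size s) =
      [set G : {set V} | (G \subset F) && has (fun F' : {set V} => G \subset F') s]%SET.
    by apply/setP => G'; rewrite !inE nth_rcons ltnn eqxx -cats1 take_size_cat.
  move=> /(_ G); rewrite inE GF Gs => /(_ isT)[G']; rewrite inE => /andP[G'F G's] [GG' cG'].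
  have /fintype.subsetPn[v vF vG'] : ~~ (F \subset G').
    by apply/negP => /fintype.subset_leq_card; rewrite cardF cG' ltnn.
  exists v; last by apply: contra vG'; apply/fintype.subsetP.
  rewrite inE vF /=; suff -> : (F :\ v)%SET = G' by [].
  apply/eqP; rewrite eq_sym finset.eqEcard finset.subsetD1 G'F vG' /= cG'.
  by rewrite cardFv.
have A0 : A != finset.set0.
  have [||v vA _] := Anew finset.set0; first exact: finset.sub0set.
    case: (s) s0 => // G s' _ /=; by rewrite finset.sub0set.
  by apply/finset.set0Pn; exists v.
have FvK0 v : v \in A -> (F :\ v)%SET != finset.set0 -> (F :\ v)%SET \in K0.
  rewrite inE => /andP[vF vs] Fv0; apply: inK0; first by rewrite inE Fv0.
  by rewrite cardFv // neq_ltn ltnSn.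
(* Equality means that the whole boundary is covered; otherwise a vertex outside [A] can receive the
   mass in a collapse. *)
have [AeqF|AneF] := eqVneq A F.
  exists K0, (F :: hs); split; split=> //.
  - by rewrite /= Fhs.
  - by move=> G; rewrite inE => /orP[/eqP->|/hs1].
  - move=> F' G; rewrite inE => /orP[/eqP-> GF G0 GneF|]; last exact: hs2.
    have /fintype.subsetPn[v vF vG] : ~~ (F \subset G).
      by apply: contra GneF => FG; rewrite finset.eqEsubset GF.
    have GFv : G \subset (F :\ v)%SET by rewrite finset.subsetD1 GF.
    apply: (dK0 (F :\ v)%SET) => //; apply: FvK0; first by rewrite AeqF.
    by apply: contra G0 => /eqP Fv0; rewrite Fv0 finset.subset0 in GFv.
  - move=> G; rewrite generated_cx_rcons genE inE.
    have [->|GneF] /= := eqVneq G F; first by rewrite subxx F0 orbT orbC.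
    have [GhK|GhK] //= := boolP ((G \in K0) || (G \in hs)).
    apply/negbTE; apply: contra GhK => /andP[GF G0].
    have /fintype.subsetPn[v vF vG] : ~~ (F \subset G).
      by apply: contra GneF => FG; rewrite finset.eqEsubset GF.
    have GFv : G \subset (F :\ v)%SET by rewrite finset.subsetD1 GF.
    rewrite (dK0 (F :\ v)%SET) //; apply: FvK0; first by rewrite AeqF.
    by apply: contra G0 => /eqP Fv0; rewrite Fv0 finset.subset0 in GFv.
have [u uF uA] : exists2 u, u \in F & u \notin A.
  by apply/fintype.subsetPn; apply: contra AneF => FA; rewrite finset.eqEsubset AF.
pose K1 : {set {set V}} := [set G : {set V} | (G \in K0) || ((G \subset F) && (G != finset.set0))]%SET.
have K1E G : (G \in K1) = (G \in K0) || ((G \subset F) && (G != finset.set0)) by rewrite inE.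
exists K1, hs; split; split=> //.
- move=> G G'; rewrite !K1E => /orP[GK0 G'G G'0|/andP[GF _] G'G G'0].
    by rewrite (dK0 G).
  by rewrite G'0 (fintype.subset_trans G'G GF) orbT.
- apply: (@contractible_cx_collapse R V K0 K1 F A u) => //.
    move=> G GK0; apply/negP => AG.
    have := dK0 _ _ GK0 AG A0 => AK0.
    have : A \in generated_cx s by rewrite genE AK0.
    by rewrite inE => /andP[_ /(Anew _ AF)[v ->]].
  move=> v vA; apply: FvK0 => //; apply/finset.set0Pn; exists u.
  by rewrite finset.in_setD1 uF andbT; apply: contraNneq uA => ->.
- by case/finset.set0Pn: K00 => G GK0; apply/finset.set0Pn; exists G; rewrite K1E GK0.
- move=> G Ghs; have [cG GK0] := hs1 _ Ghs; split=> //.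
  rewrite K1E (negbTE GK0) /=; apply/negP => /andP[GF _]; case/negP: Fhs.
  suff <- : G = F by [].
  by apply/eqP; rewrite finset.eqEcard GF cG cardF /=.
- by move=> F' G F'hs GF' G0 GneF'; rewrite K1E (hs2 F').
- by move=> G; rewrite generated_cx_rcons genE K1E -!orbA; congr (_ || _); rewrite orbC.
Qed.

End ShellingSplit.

(** * Open simplices as punctured spheres *)

Section InversionChart.
Import Order.TTheory GRing.Theory Num.Theory.
Local Open Scope ring_scope.
Variables (R : realType) (d : nat).
Implicit Types (a : 'I_d.+1 -> R) (m : R).

(* The open simplex [m > 0] is sent to R^d by [c |-> (a c - a 0) / m], with [m]
   the least coordinate, and R^d, placed at height [1 / 2], is sent to the unit
   sphere around [e_0] minus [0] by the inversion [w |-> w / |w|^2]. *)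
Definition chart a m (c : 'I_d.+1) : R := a c - a ord0 + m / 2 * (c == ord0)%:R.

Lemma chart0 a m : chart a m ord0 = m / 2.
Proof. by rewrite /chart subrr add0r eqxx mulr1. Qed.

Lemma chart_sqr_gt0 a m : 0 < m -> 0 < \sum_c chart a m c ^+ 2.
Proof.
move=> m0; rewrite (bigD1 ord0) //= chart0 ltr_pwDl //.
  by rewrite exprn_gt0 // divr_gt0.
by apply: sumr_ge0 => c _; exact: sqr_ge0.
Qed.

(** The sphere is thus [|y|^2 = 2 * y ord0], and inversion turns this into height 1/2, whence the
    term [m / 2] in [chart]. *)
Lemma sphere_sum (y : 'I_d.+1 -> R) :
  \sum_c (y c - (c == ord0)%:R) ^+ 2 = \sum_c y c ^+ 2 - 2 * y ord0 + 1.
Proof.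
rewrite (bigD1 ord0) //= [in RHS](bigD1 ord0) //=.
under eq_bigr => c /negbTE -> do rewrite subr0.
by ring.
Qed.

(** The vector is [z / |z|^2] for [z = chart a m / m]. With [m] cleared into the numerator, it
    vanishes when [m] does. *)
Lemma chart_on_sphere a m : 0 < m ->
  \sum_c (m * chart a m c / (\sum_e chart a m e ^+ 2) - (c == ord0)%:R) ^+ 2 = 1.
Proof.
move=> m0; rewrite sphere_sum chart0; have := chart_sqr_gt0 a m0.
set S := \sum_e _ => S0.
have -> : \sum_c (m * chart a m c / S) ^+ 2 = m ^+ 2 / S.
  under eq_bigr => c _ do rewrite mulrAC exprMn.
  by rewrite -mulr_sumr -/S; field; rewrite gt_eqF.
by field; rewrite gt_eqF.
Qed.

Lemma chart_inj a a' m m' : 0 < m -> 0 < m' ->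
  (forall c, m <= a c) -> (forall c, m' <= a' c) ->
  (exists c, a c = m) -> (exists c, a' c = m') ->
  \sum_c a c = 1 -> \sum_c a' c = 1 ->
  (forall c, m * chart a m c / (\sum_e chart a m e ^+ 2) =
             m' * chart a' m' c / (\sum_e chart a' m' e ^+ 2)) ->
  forall c, a c = a' c.
Proof.
move=> m0 m'0 ma ma' [c0 ac0] [c1 ac1] sa sa'.
have S0 := chart_sqr_gt0 a m0; have S'0 := chart_sqr_gt0 a' m'0.
move: S0 S'0; set S := \sum_e _; set S' := \sum_e _ => S0 S'0 eqc.
have nz := (gt_eqF m0, gt_eqF m'0, gt_eqF S0, gt_eqF S'0).
(* Inversion preserves rays, so equal images come from proportional charts. *)
pose k := S' * m / (S * m').
have ck c : chart a' m' c = k * chart a m c.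
  have : m' * chart a' m' c / S' * (S' / m') = m * chart a m c / S * (S' / m') by rewrite eqc.
  have -> : m' * chart a' m' c / S' * (S' / m') = chart a' m' c by field; rewrite !nz.
  by move=> ->; rewrite /k; field; rewrite !nz.
have mk : m' = k * m.
  by have := ck ord0; rewrite !chart0 => h; lra.
have diff c : m * (a' c - a' ord0) = m' * (a c - a ord0).
  have [->|c_neq0] := eqVneq c ord0; first by rewrite !subrr !mulr0.
  have := ck c; rewrite /chart (negbTE c_neq0) !mulr0 !addr0 => ->.
  by rewrite mk; ring.
(* By [diff] the vectors [m * a'] and [m' * a] differ by a constant, and both have least coordinate
   [m * m']. *)
have h0 : m * a' ord0 = m' * a ord0.
  apply/eqP; rewrite eq_le; apply/andP; split.
    have := diff c1; rewrite ac1 => h.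
    have : m' * m <= m' * a c1 by rewrite ler_pM2l.
    by nra.
  have := diff c0; rewrite ac0 => h.
  have : m * m' <= m * a' c0 by rewrite ler_pM2l.
  by nra.
have prop c : m * a' c = m' * a c by have := diff c; rewrite !mulrBr h0 => /addIr.
have mm' : m = m'.
  by rewrite -[LHS]mulr1 -sa' mulr_sumr (eq_bigr _ (fun c _ => prop c)) -mulr_sumr sa mulr1.
move=> c; have := prop c; rewrite -mm' => /(mulfI _) -> //.
by rewrite gt_eqF.
Qed.

Lemma chart_surj (y : 'I_d.+1 -> R) : \sum_c (y c - (c == ord0)%:R) ^+ 2 = 1 ->
  (exists c, y c != 0) ->
  exists a m, [/\ 0 < m, forall c, m <= a c, exists c, a c = m, \sum_c a c = 1 &
    forall c, m * chart a m c / (\sum_e chart a m e ^+ 2) = y c].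
Proof.
rewrite sphere_sum; set n := \sum_c _ => ny [c1 yc1].
have n2 : n = 2 * y ord0 by lra.
have n0 : 0 < n.
  rewrite lt_neqAle sumr_ge0 ?andbT => [|c _]; last exact: sqr_ge0.
  apply: contraNneq yc1 => /esym /eqP; rewrite psumr_eq0 => [|c _]; last exact: sqr_ge0.
  by move=> /allP /(_ c1 (mem_index_enum _)); rewrite sqrf_eq0.
(* Undoes the inversion and the shift by 1/2. Moving the least coordinate to 1 and dividing by the
   sum [Q] then gives a point of the simplex with least coordinate [Q^-1]. *)
pose z c := y c / n - (c == ord0)%:R / 2.
have z0 : z ord0 = 0.
  have -> : z ord0 = (n / 2) / n - 1 / 2 by rewrite /z eqxx n2 [2 * _]mulrC mulfK.
  by field; rewrite gt_eqF.
have [cm zm] : exists cm, forall c, z cm <= z c.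
  have [cm _ zm] := @arg_minP _ R 'I_d.+1 ord0 xpredT z isT.
  by exists cm => c; exact: zm.
pose q c := z c - z cm + 1.
have q1 c : 1 <= q c by rewrite /q lerDr subr_ge0.
pose Q := \sum_c q c.
have Q0 : 0 < Q.
  rewrite /Q (bigD1 ord0) //= ltr_pwDl //; first exact: lt_le_trans (q1 _).
  by apply: sumr_ge0 => c _; exact: le_trans (q1 _).
have nz := (gt_eqF n0, gt_eqF Q0).
have chartE c : chart (fun c => q c / Q) Q^-1 c = y c / (n * Q).
  rewrite /chart /q z0.
  have -> : y c = (z c + (c == ord0)%:R / 2) * n by rewrite /z; field; rewrite !nz.
  by field; rewrite !nz.
exists (fun c => q c / Q), Q^-1; split.
- by rewrite invr_gt0.
- by move=> c; rewrite ler_pdivlMr // mulVf // nz.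
- by exists cm; rewrite /q subrr add0r mul1r.
- by rewrite -mulr_suml -/Q divff // nz.
- move=> c; rewrite chartE; under eq_bigr do rewrite chartE exprMn.
  by rewrite -mulr_suml -/n; field; rewrite !nz.
Qed.

End InversionChart.

(** * Crushing the contractible subcomplex to a point *)

Section Wedge.
Import Order.TTheory GRing.Theory Num.Theory.
Local Open Scope classical_set_scope.
Local Open Scope ring_scope.
Variables (R : realType) (V : finType) (m d : nat) (sig : 'I_m -> 'I_d.+1 -> V).
Variables (K K0 : {set {set V}}).
Local Notation pt := 'rV[R]_#|V|.
Let cell i : {set V} := [set sig i c | c in 'I_d.+1]%SET.
Hypothesis sig_inj : forall i, injective (sig i).
Hypothesis cell_inj : injective cell.
Hypotheses (dK : down_closed K) (dK0 : down_closed K0) (K0_neq0 : exists2 F, F \in K0 & F != finset.set0).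
Hypothesis cK0 : contractible_cx R K0.
Hypothesis cellK0 : forall i, cell i \notin K0.
Hypothesis boundary : forall i (G : {set V}),
  G \subset cell i -> G != finset.set0 -> G != cell i -> G \in K0.
Hypothesis K_split : forall G, G \in K = (G \in K0) || [exists i, G == cell i].

Let card_cell i : #|cell i| = d.+1.
Proof. by rewrite finset.card_imset ?card_ord //; exact: sig_inj. Qed.

Let mm i (x : pt) := min_bary (cell i) x.

(** No face in [K0] contains a cell, and distinct cells have equal cardinality, so a support
    contains at most one cell. Sums over the cells therefore have at most one nonzero term. *)
Let K_cases (x : pt) : geom_realization R K x ->
  (supp x \in K0 /\ forall i, mm i x = 0) \/
  exists i, [/\ supp x = cell i, 0 < mm i x & forall j, j != i -> mm j x = 0].
Proof.
move=> Kx; have [x0 x1 xK] := (geomP K x).1 Kx.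
have mm0 i : ~~ (cell i \subset supp x) -> mm i x = 0.
  by rewrite -(min_bary_gt0 _ Kx) -leNgt => m0; apply/eqP; rewrite eq_le m0 (min_bary_ge0 _ Kx).
have [xK0|xK0] := boolP (supp x \in K0).
  left; split=> // i; apply: mm0; apply/negP => ix; case/negP: (cellK0 i).
  by apply: dK0 xK0 ix _; rewrite -finset.card_gt0 card_cell.
right; move: xK; rewrite K_split (negbTE xK0) => /existsP[i /eqP xi]; exists i.
split=> // [|j ji]; first by rewrite /mm (min_bary_gt0 _ Kx) xi.
apply: mm0; rewrite xi; apply: contra ji => ij; apply/eqP/cell_inj/eqP.
by rewrite finset.eqEcard ij /= (card_cell i) (card_cell j) leqnn.
Qed.

Let K0K (x : pt) : geom_realization R K0 x -> geom_realization R K x.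
Proof. by move=> /geomP[x0 x1 xK]; apply/geomP; split=> //; rewrite K_split xK. Qed.

Let N : R := d.+1%:R.
Let N0 : 0 < N. Proof. by rewrite ltr0n. Qed.

Let sum_cell i (F : V -> R) : (forall v, v \notin cell i -> F v = 0) ->
  \sum_v F v = \sum_c F (sig i c).
Proof.
move=> F0; rewrite (bigID (mem (cell i))) /= [X in _ + X]big1 // addr0.
by rewrite (big_imset F (in2W (@sig_inj i))) /=; apply: eq_bigl => c; rewrite inE.
Qed.

(* Extends the contraction of [|K0|] over the cells: during time [t] a point of
   a cell is pushed away from the barycentre until its least coordinate has
   dropped by [t / (2 N)], and once it has reached the boundary it follows the
   contraction for the remaining time. *)
Lemma extend_contraction : exists (G : R * pt -> pt) (p : pt),
  [/\ continuous G,
      forall (t : R) x, 0 <= t <= 1 -> geom_realization R K x -> geom_realization R K (G (t, x)),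
      forall (t : R) x, 0 <= t <= 1 -> geom_realization R K0 x -> geom_realization R K0 (G (t, x)),
      forall x, geom_realization R K x -> G (0, x) = x &
      forall x, geom_realization R K0 x -> G (1, x) = p].
Proof.
have [H [p [cH H0 HK H1]]] := cK0.
(* Subtracting [cc i] at the [N] vertices of a cell leaves mass [1 - N * cc i]. Up to time 1 this is
   at least 1/2, so the maximum in [den] is inactive on the realization and only prevents division
   by 0 elsewhere. *)
pose cc i (q : R * pt) := Num.min (mm i q.2) (q.1 / (2 * N)).
pose den q := Num.max 2^-1 (1 - N * \sum_i cc i q).
pose num q v := bary q.2 v - \sum_i cc i q * (v \in cell i)%:R.
pose y q := point_of (fun v => num q v / den q).
(* The boundary is reached at time [2 * N * mm i]; on [K0] this is 0 and the contraction runs from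
   the start. *)
pose time (q : R * pt) := Num.max 0 (q.1 - 2 * N * \sum_i mm i q.2).
have ccc i : continuous (cc i).
  apply: fun_min_continuous.
    exact: (comp_continuous (@snd_continuous _ _) (@min_bary_continuous _ _ (cell i))).
  by apply: fun_mul_continuous; [exact: fst_continuous|exact: fun_cst_continuous].
have cden : continuous den.
  apply: fun_max_continuous; first exact: fun_cst_continuous.
  apply: fun_sub_continuous; first exact: fun_cst_continuous.
  by apply: fun_mul_continuous; [exact: fun_cst_continuous|exact: fun_sum_continuous].
have cy : continuous y.
  apply: point_of_continuous => v; apply: fun_div_continuous => //.
    by move=> q; rewrite gt_eqF // lt_max invr_gt0 ltr0n.
  apply: fun_sub_continuous.
    exact: (comp_continuous (@snd_continuous _ _) (@bary_continuous _ _ v)).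
  apply: fun_sum_continuous => i.
  by apply: fun_mul_continuous; [exact: ccc|exact: fun_cst_continuous].
have ctime : continuous time.
  apply: fun_max_continuous; first exact: fun_cst_continuous.
  apply: fun_sub_continuous; first exact: fst_continuous.
  apply: fun_mul_continuous; first exact: fun_cst_continuous.
  apply: fun_sum_continuous => i.
  exact: (comp_continuous (@snd_continuous _ _) (@min_bary_continuous _ _ (cell i))).
have yid (q : R * pt) : (forall i, cc i q = 0) -> y q = q.2.
  move=> c0; apply: bary_inj => v; rewrite bary_point_of /num /den !big1 //.
    by rewrite mulr0 !subr0 max_r ?divr1 // invf_le1 ?ler1n ?ltr0n.
  by move=> i _; rewrite c0 mul0r.
have GK0 (t : R) x : 0 <= t <= 1 -> (forall i, mm i x = 0) -> H (time (t, x), y (t, x)) = H (t, x).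
  move=> /andP[t0 t1] m0; rewrite yid /=.
    by rewrite /time /= big1 ?mulr0 ?subr0 ?max_r.
  by move=> i; rewrite /cc /= m0 min_l // divr_ge0 // mulr_ge0 // ltW.
have mmK0 x : geom_realization R K0 x -> forall i, mm i x = 0.
  move=> K0x; case: (K_cases (K0K K0x)) => [[]//|[i [xi _ _]]].
  by have [_ _] := (geomP _ _).1 K0x; rewrite xi (negbTE (cellK0 i)).
exists (fun q => H (time q, y q)), p; split.
- by apply: (comp_continuous _ cH); apply: pair_continuous.
- move=> t x t01 Kx; have [x0 x1 xK] := (geomP K x).1 Kx.
  have [[xK0 m0]|[i [xi mi mj]]] := K_cases Kx.
    by rewrite GK0 //; apply/K0K/HK => //; apply/geomP.
  have /andP[t0 t1] := t01.
  have tau0 : 0 <= t / (2 * N) by rewrite divr_ge0 // mulr_ge0 // ltW.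
  have cj j : j != i -> cc j (t, x) = 0 by move=> ji; rewrite /cc /= mj // min_l.
  have ci0 : 0 <= cc i (t, x) by rewrite /cc /= le_min (ltW mi).
  have cim : cc i (t, x) <= mm i x by rewrite /cc /= ge_min lexx.
  have cit : N * cc i (t, x) <= 2^-1.
    have : cc i (t, x) <= t / (2 * N) by rewrite /cc /= ge_min lexx orbT.
    rewrite ler_pdivlMr ?mulr_gt0 // => h.
    by rewrite -[X in _ <= X]mul1r ler_pdivlMr // (le_trans _ t1) //; lra.
  have denE : den (t, x) = 1 - N * cc i (t, x).
    rewrite /den (bigD1 i) //= big1 ?addr0; last by move=> j /cj.
    by rewrite max_r //; lra.
  have den0 : 0 < den (t, x) by rewrite denE; lra.
  have numE v : num (t, x) v = bary x v - cc i (t, x) * (v \in cell i)%:R.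
    rewrite /num (bigD1 i) //= big1 ?addr0 // => j /cj ->.
    by rewrite mul0r.
  have xnot v : v \notin cell i -> bary x v = 0.
    by rewrite -xi in_supp negbK => /eqP.
  have ynot v : v \notin cell i -> bary (y (t, x)) v = 0.
    by move=> vi; rewrite bary_point_of numE (negbTE vi) xnot // mulr0 subr0 mul0r.
  have ypos v : 0 <= bary (y (t, x)) v.
    have [vi|/ynot -> //] := boolP (v \in cell i).
    rewrite bary_point_of numE vi mulr1 divr_ge0 ?(ltW den0) // subr_ge0.
    exact: le_trans (min_bary_le x vi).
  have ysum : \sum_v bary (y (t, x)) v = 1.
    under eq_bigr do rewrite bary_point_of numE.
    rewrite -mulr_suml sumrB x1 -mulr_sumr.
    have -> : \sum_v (v \in cell i)%:R = N.
      rewrite /N -(card_cell i) -sum1_card natr_sum [in RHS]big_mkcond /=.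
      by apply: eq_bigr => v _; case: (v \in cell i).
    by rewrite [_ * N]mulrC -denE divff // gt_eqF.
  have ysupp : supp (y (t, x)) \subset cell i.
    by apply/fintype.subsetP => v; rewrite in_supp; apply: contra_neqT => /ynot.
  have [mt|mt] := leP (t / (2 * N)) (mm i x).
    have -> : time (t, x) = 0.
      rewrite /time /= (bigD1 i) //= big1 ?addr0; last by move=> j /mj.
      by rewrite max_l // subr_le0; rewrite ler_pdivrMr ?mulr_gt0 // mulrC in mt.
    rewrite H0; apply/geomP; split=> //.
    have [->|yi] := eqVneq (supp (y (t, x))) (cell i).
      by rewrite K_split; apply/orP; right; apply/existsP; exists i.
    by rewrite K_split (boundary ysupp) // supp_neq0.
  apply/K0K/HK; last first.
    apply/geomP; split=> //; apply: (boundary ysupp); first exact: supp_neq0.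
    have [|v vi mv] := min_bary_attained (A := cell i) Kx.
      by rewrite -finset.card_gt0 card_cell.
    apply: contraTneq vi => <-; rewrite in_supp negbK bary_point_of numE.
    rewrite /cc /= min_l ?(ltW mt) // /mm mv.
    by case: (boolP (v \in cell i)) => vi; rewrite ?mulr1 ?subrr ?mul0r // xnot // mulr0 subr0 mul0r.
  rewrite /time le_max lexx /= ge_max ler01 /= (bigD1 i) //= big1 ?addr0; last by move=> j /mj.
  by rewrite lerBlDr (le_trans t1) // lerDl !mulr_ge0 // ltW.
- by move=> t x t01 K0x; rewrite GK0 //; [exact: HK|exact: mmK0].
- move=> x Kx.
  have mge i : 0 <= mm i x by exact: min_bary_ge0 Kx.
  rewrite yid => [|i]; last by rewrite /cc /= mul0r min_r.
  rewrite /time /= max_l ?H0 // sub0r oppr_le0 !mulr_ge0 ?(ltW N0) //.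
  by apply: sumr_ge0 => i _; exact: mge.
- by move=> x K0x; rewrite GK0 ?ler01 ?lexx //; [exact: H1|exact: mmK0].
Qed.

Let a i (x : pt) c := bary x (sig i c).
(* The last summand vanishes on the cell and keeps [D] nonzero elsewhere. *)
Let D i (x : pt) := \sum_c chart (a i x) (mm i x) c ^+ 2 + (1 - \sum_c a i x c) ^+ 2.
Let wmap (x : pt) : 'M[R]_(m, d.+1) :=
  \matrix_(i, c) (mm i x * chart (a i x) (mm i x) c / D i x).

(** Were all squares 0, the coordinates on the cell would be equal with minimum 0, against their sum
    being 1. This holds at every point of the ambient space, as global continuity of [wmap]
    requires. *)
Let D_neq0 i x : D i x != 0.
Proof.
apply/negP; rewrite /D paddr_eq0; last exact: sqr_ge0; last first.
  by apply: sumr_ge0 => c _; exact: sqr_ge0.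
rewrite psumr_eq0; last by move=> c _; exact: sqr_ge0.
move=> /andP[/allP ch0]; rewrite sqrf_eq0 subr_eq0 => /eqP sa.
have {}ch0 c : chart (a i x) (mm i x) c = 0.
  by apply/eqP; rewrite -sqrf_eq0; apply: (ch0 c (mem_index_enum _)).
have mm0 : mm i x = 0 by have := ch0 ord0; rewrite chart0; lra.
have ac c : a i x c = a i x ord0.
  by have := ch0 c; rewrite /chart mm0 !mul0r addr0 => /eqP; rewrite subr_eq0 => /eqP.
have a0 : a i x ord0 != 0.
  apply/eqP => a0; move: sa; rewrite big1 => [/eqP|c _]; last by rewrite ac a0.
  by rewrite oner_eq0.
case: (min_bary_or (cell i) x); rewrite -/(mm i x) mm0.
  by move/eqP; rewrite eq_sym oner_eq0.
by move=> [_ /finset.imsetP[c _ ->]] h; case/eqP: a0; rewrite -(ac c).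
Qed.

Let wmap_continuous : continuous wmap.
Proof.
have ca i c : continuous (fun x => a i x c) by exact: bary_continuous.
have cm i : continuous (mm i) by exact: min_bary_continuous.
have cch i c : continuous (fun x => chart (a i x) (mm i x) c).
  apply: fun_add_continuous; first by apply: fun_sub_continuous; exact: ca.
  apply: fun_mul_continuous; last exact: fun_cst_continuous.
  by apply: fun_mul_continuous; [exact: cm|exact: fun_cst_continuous].
apply: mx_continuous => i c.
have -> : (fun x => wmap x i c) = (fun x => mm i x * chart (a i x) (mm i x) c / D i x).
  by apply/funext => x; rewrite mxE.
apply: fun_div_continuous; first exact: D_neq0.
  by apply: fun_mul_continuous; [exact: cm|exact: cch].
apply: fun_add_continuous.
  by apply: fun_sum_continuous => e; apply: fun_mul_continuous; exact: cch.
by apply: fun_mul_continuous; apply: fun_sub_continuous;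
  [exact: fun_cst_continuous|exact: fun_sum_continuous
  |exact: fun_cst_continuous|exact: fun_sum_continuous].
Qed.

Let wmap_row0 x i c : mm i x = 0 -> wmap x i c = 0.
Proof. by move=> m0; rewrite mxE m0 !mul0r. Qed.

Let cell_data x i : geom_realization R K x -> supp x = cell i ->
  [/\ forall c, mm i x <= a i x c, exists c, a i x c = mm i x & \sum_c a i x c = 1].
Proof.
move=> Kx xi; have [x0 x1 xK] := (geomP K x).1 Kx; split.
- by move=> c; apply: min_bary_le; apply/finset.imsetP; exists c.
- have [|v /finset.imsetP[c _ ->] mv] := min_bary_attained (A := cell i) Kx.
    by rewrite -finset.card_gt0 card_cell.
  by exists c; rewrite /mm mv.
- by rewrite -x1 (@sum_cell i) // => v; rewrite -xi in_supp negbK => /eqP.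
Qed.

Let wmap_cell x i c : geom_realization R K x -> supp x = cell i ->
  wmap x i c = mm i x * chart (a i x) (mm i x) c / (\sum_e chart (a i x) (mm i x) e ^+ 2).
Proof.
by move=> Kx /(cell_data Kx)[_ _ s1]; rewrite mxE /D s1 subrr expr0n addr0.
Qed.

Let wmap_cell_neq0 x i : geom_realization R K x -> supp x = cell i -> 0 < mm i x ->
  wmap x i ord0 != 0.
Proof.
move=> Kx xi m0; rewrite wmap_cell // chart0 gt_eqF // divr_gt0 ?chart_sqr_gt0 //.
by rewrite mulr_gt0 // divr_gt0.
Qed.

Let wmap_image : wmap @` geom_realization R K = wedge_spheres R m d.
Proof.
apply/seteqP; split=> [_ [x Kx <-]|M].
  have [[xK0 m0]|[i [xi mi mj]]] := K_cases Kx.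
    by left; apply/matrixP => i c; rewrite wmap_row0 // mxE.
  right; exists i; split.
    by move=> j ji; apply/rowP => c; rewrite mxE wmap_row0 ?mj // mxE.
  by under eq_bigr do rewrite wmap_cell //; exact: chart_on_sphere.
(* A vertex of [K0] supplies a preimage of the wedge point, even when there are no cells. *)
have vertexK0 : exists2 x : pt, geom_realization R K0 x & supp x \in K0.
  have [F FK0 /finset.set0Pn[w wF]] := K0_neq0.
  pose x : pt := point_of (fun v => (v == w)%:R).
  have sx : supp x = [set w]%SET.
    by apply/setP => v; rewrite in_supp bary_point_of inE; case: (v == w); rewrite ?oner_eq0 ?eqxx.
  have wK0 : [set w]%SET \in K0.
    by apply: dK0 FK0 _ _; rewrite ?finset.sub1set // -finset.card_gt0 finset.cards1.
  exists x; last by rewrite sx.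
  apply/geomP; split; rewrite ?sx //; first by move=> v; rewrite bary_point_of.
  rewrite (bigD1 w) //= bary_point_of eqxx big1 ?addr0 // => v /negbTE vw.
  by rewrite bary_point_of vw.
have [x K0x xK0] := vertexK0.
have zero : (wmap @` geom_realization R K) 0.
  exists x; first exact: K0K.
  have [[_ m0]|[i [xi _ _]]] := K_cases (K0K K0x).
    by apply/matrixP => i c; rewrite wmap_row0 // mxE.
  by move: xK0; rewrite xi (negbTE (cellK0 i)).
case=> [->//|[i [Mj Mi]]].
have Mj0 j c : j != i -> M j c = 0 by move=> /Mj /rowP /(_ c); rewrite !mxE.
have [/forallP Mi0|] := boolP [forall c, M i c == 0].
  suff -> : M = 0 by [].
  apply/matrixP => j c; rewrite mxE.
  by have [->|/Mj0->//] := eqVneq j i; apply/eqP.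
rewrite negb_forall => /existsP[c1 Mc1].
have [al [mu [mu0 mua [c0 ac0] sa aM]]] := chart_surj Mi (ex_intro _ c1 Mc1).
pose z : pt := point_of (fun v => \sum_c al c * (v == sig i c)%:R).
have zsig c : bary z (sig i c) = al c.
  rewrite bary_point_of (bigD1 c) //= eqxx mulr1 big1 ?addr0 // => e ec.
  by rewrite (inj_eq (@sig_inj i)) eq_sym (negbTE ec) mulr0.
have znot v : v \notin cell i -> bary z v = 0.
  move=> vi; rewrite bary_point_of big1 // => c _.
  have /negbTE -> : v != sig i c; last by rewrite mulr0.
  by apply: contraNneq vi => ->; apply/finset.imsetP; exists c.
have zi : supp z = cell i.
  apply/setP => v; rewrite in_supp; have [/finset.imsetP[c _ ->]|/znot->] := boolP (v \in cell i).
    by rewrite zsig gt_eqF // (lt_le_trans mu0).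
  by rewrite eqxx.
have Kz : geom_realization R K z.
  apply/geomP; split.
  - move=> v; have [/finset.imsetP[c _ ->]|/znot->//] := boolP (v \in cell i).
    by rewrite zsig (le_trans (ltW mu0)).
  - by rewrite (@sum_cell i) // -sa; apply: eq_bigr => c _; rewrite zsig.
  - by rewrite K_split zi; apply/orP; right; apply/existsP; exists i.
have az c : a i z c = al c by exact: zsig.
have mz : mm i z = mu.
  have [le [c' mc'] _] := cell_data Kz zi.
  apply/eqP; rewrite eq_le -{2}mc' az mua andbT -ac0 -az; exact: le.
have mj j : j != i -> mm j z = 0.
  have [[_ m0]|[i' [zi' _ mj]]] := K_cases Kz; first by move=> _; exact: m0.
  by move: mj; rewrite (cell_inj (etrans (esym zi') zi)) => mj; exact: mj.
exists z => //; apply/matrixP => j c.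
have [->|ji] := eqVneq j i; last by rewrite wmap_row0 ?mj // Mj0.
rewrite wmap_cell // mz -aM.
by have -> : a i z = al by apply/funext.
Qed.

Lemma wedge_homotopy_equiv : homotopy_equiv R (geom_realization R K) (wedge_spheres R m d).
Proof.
have [G [p [cG GK GK0 G0 G1]]] := extend_contraction.
rewrite -wmap_image.
apply: (@quotient_homotopy_equiv R _ _ _ (geom_realization R K0) wmap G p) => //.
- exact: geom_realization_compact.
- have w0 x : geom_realization R K0 x -> wmap x = 0.
    move=> K0x; have [[_ m0]|[i [xi _ _]]] := K_cases (K0K K0x).
      by apply/matrixP => i c; rewrite wmap_row0 // mxE.
    by have [_ _] := (geomP _ _).1 K0x; rewrite xi (negbTE (cellK0 i)).
  by move=> x x' /w0 -> /w0 ->.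
- move=> x x' Kx Kx' wxx'.
  have inK0 z : geom_realization R K z -> supp z \in K0 -> geom_realization R K0 z.
    by move=> /geomP[z0 z1 _] zK0; apply/geomP.
  have [[xK0 m0]|[i [xi mi mj]]] := K_cases Kx;
    have [[xK0' m0']|[i' [xi' mi' mj']]] := K_cases Kx'.
  + by right; split; exact: inK0.
  + by have := wmap_cell_neq0 Kx' xi' mi'; rewrite -wxx' wmap_row0 ?eqxx.
  + by have := wmap_cell_neq0 Kx xi mi; rewrite wxx' wmap_row0 ?eqxx.
  + have ii' : i' = i.
      apply/eqP; have := wmap_cell_neq0 Kx xi mi; rewrite wxx'; apply: contraNT => ii'.
      by rewrite wmap_row0 // mj' // eq_sym.
    rewrite {}ii' in xi' mi' mj'.
    left; apply: bary_inj => v.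
    have [/finset.imsetP[c _ ->]|vi] := boolP (v \in cell i); last first.
      have xv z : supp z = cell i -> bary z v = 0.
        by move=> zi; apply/eqP; rewrite -[_ == 0]negbK -in_supp zi.
      by rewrite !xv.
    have [le ex s1] := cell_data Kx xi; have [le' ex' s1'] := cell_data Kx' xi'.
    apply: (chart_inj mi mi' le le' ex ex' s1 s1') => e.
    by rewrite -!wmap_cell // wxx'.
Qed.

End Wedge.

(** * From a shelling to the wedge, and the theorem *)

Section ShellableWedge.
Import Order.TTheory GRing.Theory Num.Theory.
Local Open Scope ring_scope.

Lemma facet_above (V : finType) (K : {set {set V}}) (G : {set V}) : G \in K ->
  exists2 F, F \in facets_cx K & G \subset F.
Proof.
move=> GK; have [F /maxsetP[FK Fmax] GF] := @maxset_exists V (mem K) G GK.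
have {}FK : F \in K by [].
exists F => //; rewrite inE FK; apply/forall_inP => F' F'K; apply/implyP => FF'.
by rewrite (Fmax F').
Qed.

(** The number of spheres is the number of postponed facets; enumerating the vertices of each gives
    the coordinates of its chart. *)
Lemma shelling_homotopy_equiv_wedge (R : realType) (V : finType) (d : nat)
    (K : {set {set V}}) (s : seq {set V}) :
  K != finset.set0 -> finset.set0 \notin K -> down_closed K -> pure_cx K d ->
  uniq s -> (forall F, F \in s <-> F \in facets_cx K) ->
  (forall j, (0 < j < size s)%N -> pure_dim_pred (shell_inter s j) d) ->
  exists m, homotopy_equiv R (geom_realization R K) (wedge_spheres R m d).
Proof.
move=> /finset.set0Pn[G0 G0K] K0 dK pK us sE shell.
have s0 : (0 < size s)%N.
  by have [F /sE] := facet_above G0K; case: (s).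
have cards F : F \in s -> #|F| = d.+1 by move=> /sE /pK.
have genE G : (G \in K) = (G \in generated_cx s).
  rewrite inE; apply/idP/andP => [GK|[Gneq0 /hasP[F /sE]]].
    split; first by apply: contraNneq K0 => <-.
    by have [F /sE Fs GF] := facet_above GK; apply/hasP; exists F.
  by rewrite inE => /andP[FK _] GF; exact: dK FK GF Gneq0.
have [L [hs [[dL cL L0] [uhs hs1 hs2 hsE]]]] := shelling_split R us s0 cards shell.
pose cell (i : 'I_(size hs)) := nth finset.set0 hs i.
have cellhs i : cell i \in hs by rewrite mem_nth.
(* Only a default value for [nth], taken from a facet, which is nonempty. *)
have [w _] : exists w : V, true.
  by have := cards _ (mem_nth finset.set0 s0) => /eqP; case: (set_0Vmem (nth finset.set0 s 0)) => [->|[w _]];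
    [rewrite finset.cards0|exists w].
pose sig (i : 'I_(size hs)) (c : 'I_d.+1) := nth w (enum (cell i)) c.
have szc i : size (enum (cell i)) = d.+1 by rewrite -cardE; have [] := hs1 _ (cellhs i).
have cellE i : [set sig i c | c in 'I_d.+1]%SET = cell i.
  apply/setP => v; apply/finset.imsetP/idP => [[c _ ->]|vi].
    by rewrite -mem_enum mem_nth // szc.
  rewrite -mem_enum in vi; have iv := vi; rewrite -index_mem szc in iv.
  by exists (Ordinal iv) => //; rewrite /sig /= nth_index.
exists (size hs); apply: (@wedge_homotopy_equiv R V _ d sig K L) => //.
- by move=> i c c' /eqP; rewrite nth_uniq ?szc ?enum_uniq // => /eqP /val_inj.
- by move=> i j /=; rewrite !cellE => /eqP; rewrite nth_uniq // => /eqP /val_inj.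
- case/finset.set0Pn: L0 => G GL; exists G => //; apply: contraNneq K0 => <-.
  by rewrite genE hsE GL.
- by move=> i; rewrite cellE; have [] := hs1 _ (cellhs i).
- by move=> i G; rewrite cellE; exact: hs2 (cellhs i).
- move=> G; rewrite genE hsE; congr (_ || _); apply/idP/existsP => [Ghs|[i /eqP->]].
    by rewrite -index_mem in Ghs; exists (Ordinal Ghs); rewrite cellE /cell /= nth_index // -index_mem.
  by rewrite cellE.
Qed.

End ShellableWedge.

Theorem theorem3p4 (R : realType) (n k : nat) (Sb : {set 'I_n})
  (B : {set {set 'I_n}}) :
  building_set Sb B -> chordal B ->
  #|Sb| = (2 * k)%N -> (2 <= k)%N ->
  (forall C, C \in bs_components B -> ~~ odd #|C|) ->
  shellable_cx (order_complex (proper_part_PB Sb B)) /\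
  exists m : nat,
    homotopy_equiv R (geom_realization R (order_complex (proper_part_PB Sb B)))
                          (wedge_spheres R m (k - 2)).
Proof.
move=> bB chB cS k2 evB; have SL := hatP_full bB evB.
have pure := shelling_pure bB chB SL cS k2.
have shells := shelling_shells bB chB SL cS k2.
split.
  exists (k - 2)%N; split; first exact: pure.
  exists (shelling k Sb B); split; [exact: uniq_shelling| |exact: shells].
  by move=> F; rewrite mem_shelling.
apply: (@shelling_homotopy_equiv_wedge R _ _ _ (shelling k Sb B)) => //.
- exact: order_complex_neq0 bB chB SL cS k2.
- by rewrite inE eqxx.
- move=> F G /order_complexP[_ FP cF] GF G0; apply/order_complexP; split=> //.
    exact: fintype.subset_trans FP.
  by move=> X Y XG YG; apply: cF; apply: (fintype.subsetP GF).
- exact: uniq_shelling.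
- by move=> F; rewrite mem_shelling.
Qed.
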